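(* Let $\Gamma$ be a finitely generated nilpotent group. Then: (1) For any subgroup $G\leq IA^{*}(\Gamma)$, the natural map $\hat{G}\to IA^{*}(\hat{\Gamma})$ is injective; in other words $C(G,\Gamma)=\{e\}$. (2) The image of $IA^{*}(\Gamma)$ is dense in $IA^{*}(\hat{\Gamma})$.
   Context: For a group $X$, $\hat{X}$ is its profinite completion. Let $\Gamma^{*}=(\Gamma/[\Gamma,\Gamma])/tor(\Gamma/[\Gamma,\Gamma])\cong\mathbb{Z}^{d}$. Define $IA^{*}(\Gamma)=\ker(Aut(\Gamma)\to Aut(\Gamma^{*}))$ and $IA^{*}(\hat{\Gamma})=\ker(Aut(\hat{\Gamma})\to Aut(\widehat{\Gamma^{*}})=GL_{d}(\hat{\mathbb{Z}}))$. For $G\leq Aut(\Gamma)$, $C(G,\Gamma)$ is the kernel of the natural map $\hat{G}\to Aut(\hat{\Gamma})$. *)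

(* Defs.v *)
From Stdlib Require Import List Arith FunctionalExtensionality ProofIrrelevance.
Set Implicit Arguments.
Unset Strict Implicit.

Record group := Group {
  gcar :> Type;
  gmul : gcar -> gcar -> gcar;
  ginv : gcar -> gcar;
  gone : gcar;
  gmulA : forall x y z, gmul x (gmul y z) = gmul (gmul x y) z;
  gmul1l : forall x, gmul gone x = x;
  gmulVl : forall x, gmul (ginv x) x = gone }.
Arguments gmul {g}.
Arguments ginv {g}.
Arguments gone {g}.

Section GroupDefs.
Variable G : group.

Definition subset (A B : G -> Prop) : Prop := forall x, A x -> B x.

Definition subgroup (H : G -> Prop) : Prop :=
  H gone /\ (forall x y, H x -> H y -> H (gmul x y)) /\ (forall x, H x -> H (ginv x)).

Definition FIN (Sg N : G -> Prop) : Prop :=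
  subgroup N /\ subset N Sg /\
  (forall s n, Sg s -> N n -> N (gmul (gmul s n) (ginv s))) /\
  exists l : list G, (forall r, In r l -> Sg r) /\
    forall s, Sg s -> exists r, In r l /\ N (gmul (ginv r) s).

Definition is_coset (Sg N c : G -> Prop) : Prop :=
  exists r, Sg r /\ forall z, c z <-> N (gmul (ginv r) z).

(* Families indexed by subsets; an element of the profinite completion of Sg is a
   compatible family of cosets x N of all finite-index normal subgroups N of Sg
   (the inverse limit of the finite quotients Sg/N), empty off those indices. *)
Definition Fam := (G -> Prop) -> (G -> Prop).

Definition completion_elem (Sg : G -> Prop) (x : Fam) : Prop :=
  (forall N, FIN Sg N -> is_coset Sg N (x N)) /\
  (forall N, ~ FIN Sg N -> forall z, ~ x N z) /\
  (forall N M, FIN Sg N -> FIN Sg M -> subset N M -> subset (x N) (x M)).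

Definition gen (A : G -> Prop) (x : G) : Prop :=
  forall H, subgroup H -> subset A H -> H x.

Definition fin_gen : Prop := exists l : list G, forall x, gen (fun y => In y l) x.

Definition comm (x y : G) : G := gmul (gmul (ginv x) (ginv y)) (gmul x y).

Fixpoint lcs (n : nat) : G -> Prop :=
  match n with
  | 0 => fun _ => True
  | Datatypes.S n => gen (fun z => exists a b, lcs n a /\ z = comm a b)
  end.

Definition nilpotent : Prop := exists c, forall x, lcs c x -> x = gone.

Definition gpow (x : G) (n : nat) : G := Nat.iter n (gmul x) gone.

(* K = kernel of G -> G* = (G/[G,G]) / tor : elements whose image in G^ab is torsion *)
Definition Kstar (y : G) : Prop :=
  exists n, 0 < n /\ gen (fun z => exists a b, z = comm a b) (gpow y n).

Definition hmul (x y : Fam) : Fam :=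
  fun N z => exists a b, x N a /\ y N b /\ z = gmul a b.

Definition hat (x : Fam) : Prop := completion_elem (fun _ => True) x.
Definition FING (N : G -> Prop) : Prop := FIN (fun _ => True) N.

Definition is_haut (phi : Fam -> Fam) : Prop :=
  (forall x, hat x -> hat (phi x)) /\
  (forall x y, hat x -> hat y -> phi (hmul x y) = hmul (phi x) (phi y)) /\
  (forall x y, hat x -> hat y -> phi x = phi y -> x = y) /\
  (forall y, hat y -> exists x, hat x /\ phi x = y) /\
  (forall N, FING N -> exists M, FING M /\
      forall x y, hat x -> hat y -> x M = y M -> phi x N = phi y N).

(* IA*(G^): automorphisms inducing the identity on (G* )^ = lim G/N, N ⊇ K *)
Definition IAhat (phi : Fam -> Fam) : Prop :=
  is_haut phi /\
  forall x, hat x -> forall N, FING N -> subset Kstar N -> phi x N = x N.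

End GroupDefs.

Record aut (G : group) := Aut {
  af : G -> G;
  ag : G -> G;
  af_hom : forall x y, af (gmul x y) = gmul (af x) (af y);
  afK : forall x, ag (af x) = x;
  agK : forall x, af (ag x) = x }.
Arguments af {G}.
Arguments ag {G}.

Section AutGroup.
Variable G : group.

Lemma aut_ext (a b : aut G) : (forall x, af a x = af b x) -> a = b.
Proof.
destruct a as [f g hf fK gK], b as [f' g' hf' fK' gK']; simpl; intro H.
assert (f = f') by (apply functional_extensionality; auto). subst f'.
assert (g = g').
{ apply functional_extensionality; intro y. rewrite <- (gK' y) at 1.
  rewrite fK. reflexivity. }
subst g'. f_equal; apply proof_irrelevance.
Qed.

Definition aut_mul (a b : aut G) : aut G.
Proof.
refine (@Aut G (fun x => af a (af b x)) (fun x => ag b (ag a x)) _ _ _).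
- intros x y. rewrite (af_hom b), (af_hom a). reflexivity.
- intro x. rewrite (afK a), (afK b). reflexivity.
- intro x. rewrite (agK b), (agK a). reflexivity.
Defined.

Definition aut_inv (a : aut G) : aut G.
Proof.
refine (@Aut G (ag a) (af a) _ (agK a) (afK a)).
intros x y. rewrite <- (afK a (gmul (ag a x) (ag a y))).
rewrite (af_hom a), !(agK a). reflexivity.
Defined.

Definition aut_one : aut G :=
  @Aut G (fun x => x) (fun x => x) (fun x y => eq_refl) (fun x => eq_refl) (fun x => eq_refl).

Definition aut_group : group.
Proof.
refine (@Group (aut G) aut_mul aut_inv aut_one _ _ _).
- intros; apply aut_ext; reflexivity.
- intros; apply aut_ext; reflexivity.
- intro a; apply aut_ext; intro x; simpl. apply (afK a).
Defined.

Definition IA (s : aut G) : Prop := forall x, Kstar (gmul (ginv x) (af s x)).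

Definition act (s : aut G) (x : Fam G) : Fam G :=
  fun N z => exists w, x (fun v => N (af s v)) w /\ z = af s w.

(* natural map  Gsub^ -> Aut(G^)  for a subgroup Gsub of Aut(G): the continuous
   extension of s |-> act s.  For g in Gsub^, (nu g x)_N = (act s x)_N for any s
   in the coset g_H, H a finite-index normal subgroup of Gsub acting trivially on G/N. *)
Definition nu (Gsub : aut_group -> Prop) (g : Fam aut_group) (x : Fam G) : Fam G :=
  fun N z => exists (H : aut_group -> Prop) (s : aut_group),
    FIN Gsub H /\
    (forall t : aut_group, H t -> forall w, N (gmul (ginv w) (af t w))) /\
    g H s /\ act s x N z.

End AutGroup.

(* Main.v *)
(* Everything rests on Mal'cev's theorem that subgroups of a polycyclic group are closed in its
   profinite topology, proved by induction along the cyclic factors.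

   (1) Filter a group [Gs] of automorphisms by its action modulo the terms [gam n] of the lower central series.
   If [Gs] is trivial modulo [gam n], n >= 1, then s |-> y^-1 s(y) is a homomorphism to [gam n / gam n.+1]
   for each generator y. Separability of its image shows that the congruence subgroup property passes
   from its kernel to [Gs]. The first layer is finite because Kstar / [gam 1] is.

   (2) A continuous automorphism phi trivial on the completion of Gam* prescribes an honest tuple (a x) modulo [gam 1].
   Present Gam by words modulo relators R. Tuples y = a mod [gam 1] killing R modulo [gam i] and
   approximating phi are improved one relator at a time: the possible values of a relator r of depth j
   form a coset of a subgroup modulo [gam i.+1], and phi shows that 1 is in the closure of that coset, hence in it.
   Once [gam i] is trivial, y defines an automorphism. *)

From Stdlib Require Import List Arith ZArith Lia ssreflect ssrbool.
From Stdlib Require Import Classical ClassicalEpsilon FunctionalExtensionality PropExtensionality ProofIrrelevance.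
Require Import Defs.
Set Implicit Arguments.
Unset Strict Implicit.

Declare Scope grp_scope.
Delimit Scope grp_scope with grp.
Local Notation "x * y" := (gmul x y) : grp_scope.
Local Notation "x ^-1" := (ginv x) (at level 3, left associativity, format "x ^-1") : grp_scope.
Local Open Scope grp_scope.

(** * Groups, congruences and finite index *)

(** The obstacle in (2) is that the value of a relator is not a homomorphic function of the tuple.
    Lifts only carry a ternary operation, which plays the role of [y \o y1^-1 \o y'], and a relator
    in [gam j] respects it modulo [gam i.+1] only if the relators in [gam j.+1] already vanish
    there. This forces the order of the improvements, from the deepest relators upwards. Relators
    are taken in a relatively free group, not in a free one: it is nilpotent and finitely generated,
    hence polycyclic, so the relators of a given depth are finitely generated and finitely many
    improvements suffice for each layer. Two devices recur. The subgroups generated by m-th powers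
    are invariant under automorphisms and cofinal among the normal subgroups of finite index, so
    they replace arbitrary ones. And some finite-index subgroup meets [Kstar] inside [gam 1], which
    turns information about the torsion-free quotient into information modulo [gam 1]. *)

Lemma pred_ext (X : Type) (A B : X -> Prop) : (forall x, A x <-> B x) -> A = B.
Proof. by move=> h; apply: functional_extensionality => x; apply: propositional_extensionality. Qed.

Lemma fchoice (X Y : Type) (R : X -> Y -> Prop) :
  (forall x, exists y, R x y) -> exists f, forall x, R x (f x).
Proof.
move=> h; exists (fun x => proj1_sig (constructive_indefinite_description _ (h x))) => x.
by case: (constructive_indefinite_description _ _).
Qed.

Section Basics.
Variable G : group.
Implicit Types (x y z : G) (S N D K : G -> Prop).

Lemma gmulVr x : x * x^-1 = gone.
Proof.
by rewrite -(gmul1l (x * _)) -{1}(gmulVl (x^-1)) -gmulA (gmulA x^-1) gmulVl gmul1l gmulVl.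
Qed.

Lemma gmul1r x : x * gone = x.
Proof. by rewrite -(gmulVl x) gmulA gmulVr gmul1l. Qed.

Lemma gmulK x y : x * (x^-1 * y) = y.
Proof. by rewrite gmulA gmulVr gmul1l. Qed.

Lemma gmulVK x y : x^-1 * (x * y) = y.
Proof. by rewrite gmulA gmulVl gmul1l. Qed.

Lemma gmulI x y z : x * y = x * z -> y = z.
Proof. by move=> h; rewrite -(gmulVK x y) h gmulVK. Qed.

Lemma ginvK x : x^-1^-1 = x.
Proof. by apply: (@gmulI x^-1); rewrite gmulVl gmulVr. Qed.

Lemma ginvM x y : (x * y)^-1 = y^-1 * x^-1.
Proof. by apply: (@gmulI (x * y)); rewrite gmulVr -gmulA gmulK gmulVr. Qed.

Lemma ginv1 : (gone : G)^-1 = gone.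
Proof. by apply: (@gmulI gone); rewrite gmulVr gmul1l. Qed.

Lemma gmulAr x y z : (x * y) * z = x * (y * z).
Proof. by rewrite gmulA. Qed.
End Basics.

Global Hint Rewrite gmulAr gmul1l gmul1r gmulVl gmulVr gmulK gmulVK ginvK ginvM ginv1 : grp.
Ltac gsimp := autorewrite with grp.
Ltac grp := rewrite ?/comm; gsimp; reflexivity.

Section Cong.
Variable G : group.
Implicit Types (x y z : G) (S N D K : G -> Prop).

Definition cong N x y := N (x^-1 * y).
Definition normalized S N := forall s n, S s -> N n -> N (s * n * s^-1).
Definition whole : G -> Prop := fun _ => True.

Lemma sub1 S : subgroup S -> S gone. Proof. by case. Qed.
Lemma subM S x y : subgroup S -> S x -> S y -> S (x * y). Proof. by case=> _ [h _]; apply: h. Qed.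
Lemma subV S x : subgroup S -> S x -> S x^-1. Proof. by case=> _ [_]; apply. Qed.
Lemma subVr S x : subgroup S -> S x^-1 -> S x.
Proof. by move=> h /(subV h); rewrite ginvK. Qed.
Lemma subMl S x y : subgroup S -> S x -> S (x * y) -> S y.
Proof. by move=> h hx /(subM h (subV h hx)); rewrite gmulVK. Qed.
Lemma subMr S x y : subgroup S -> S y -> S (x * y) -> S x.
Proof. by move=> h hy hxy; have := subM h hxy (subV h hy); gsimp. Qed.

Lemma whole_sub : subgroup whole. Proof. by []. Qed.

Lemma cong_refl N x : subgroup N -> cong N x x.
Proof. by move=> h; rewrite /cong gmulVl; apply: sub1. Qed.
Lemma cong_sym N x y : subgroup N -> cong N x y -> cong N y x.
Proof. by move=> h /(subV h); rewrite ginvM ginvK. Qed.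
Lemma cong_trans N y x z : subgroup N -> cong N x y -> cong N y z -> cong N x z.
Proof. by move=> h h1 h2; have := subM h h1 h2; rewrite /cong; gsimp. Qed.
Lemma cong_in N x y : subgroup N -> cong N x y -> N x -> N y.
Proof. by move=> h h1 /(subM h)/(_ h1); gsimp. Qed.
Lemma cong_1 N x : cong N gone x <-> N x.
Proof. by rewrite /cong ginv1 gmul1l. Qed.
Lemma cong_mem N x y : subgroup N -> N x -> N y -> cong N x y.
Proof. by move=> h hx hy; apply: subM => //; apply: subV. Qed.
Lemma cong_mono N D x y : subset N D -> cong N x y -> cong D x y.
Proof. by move=> h; apply: h. Qed.

Lemma normalizedV S N s n : subgroup S -> normalized S N -> S s -> N n -> N (s^-1 * n * s).
Proof. by move=> hS h hs hn; have := h s^-1 n (subV hS hs) hn; rewrite ginvK. Qed.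

Lemma normalized_mono S D N : subset D S -> normalized S N -> normalized D N.
Proof. by move=> h h1 s n hs; apply: h1; apply: h. Qed.

Lemma cong_mul S N x x' y y' : subgroup S -> subgroup N -> normalized S N -> S y ->
  cong N x x' -> cong N y y' -> cong N (x * y) (x' * y').
Proof.
move=> hS hN nN hy h1 h2; have := subM hN (normalizedV hS nN hy h1) h2.
by rewrite /cong; gsimp.
Qed.

Lemma cong_mull N x y y' : cong N y y' -> cong N (x * y) (x * y').
Proof. by rewrite /cong; gsimp. Qed.

Lemma cong_inv S N x y : subgroup S -> subgroup N -> normalized S N -> S x ->
  cong N x y -> cong N x^-1 y^-1.
Proof.
move=> hS hN nN hx h; have := nN _ _ hx (subV hN h).
by rewrite /cong; gsimp.
Qed.

Definition interP (A B : G -> Prop) : G -> Prop := fun x => A x /\ B x.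

Lemma inter_sub A B : subgroup A -> subgroup B -> subgroup (interP A B).
Proof.
move=> hA hB; split; [by split; apply: sub1|split].
  by move=> x y [? ?] [? ?]; split; apply: subM.
by move=> x [? ?]; split; apply: subV.
Qed.

Lemma inter_normalized S A B : normalized S A -> normalized S B -> normalized S (interP A B).
Proof. by move=> hA hB s n hs [? ?]; split; [apply: hA|apply: hB]. Qed.

Definition prodP (A B : G -> Prop) : G -> Prop := fun x => exists a b, A a /\ B b /\ x = a * b.

Lemma prodP_sub A B : subgroup A -> subgroup B -> normalized A B -> subgroup (prodP A B).
Proof.
move=> hA hB nB; split; [|split].
- by exists gone, gone; rewrite gmul1l; split; [apply: sub1|split=> //; apply: sub1].
- move=> _ _ [a [b [ha [hb ->]]]] [a' [b' [ha' [hb' ->]]]].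
  exists (a * a'), (a'^-1 * b * a' * b'); split; [exact: subM|split; [|by grp]].
  by apply: subM => //; apply: (normalizedV hA nB).
- move=> _ [a [b [ha [hb ->]]]]; exists a^-1, (a * b^-1 * a^-1).
  by split; [apply: subV|split; [apply: nB => //; apply: subV|grp]].
Qed.

Lemma prodP_l A B : subgroup B -> subset A (prodP A B).
Proof. by move=> hB x hx; exists x, gone; rewrite gmul1r; split=> //; split=> //; apply: sub1. Qed.
Lemma prodP_r A B : subgroup A -> subset B (prodP A B).
Proof. by move=> hB x hx; exists gone, x; rewrite gmul1l; split=> //; apply: sub1. Qed.

Lemma prodP_normalized S A B : normalized S A -> normalized S B -> normalized S (prodP A B).
Proof.
move=> hA hB s _ hs [a [b [ha [hb ->]]]]; exists (s * a * s^-1), (s * b * s^-1).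
by split; [apply: hA|split; [apply: hB|grp]].
Qed.

Lemma gen_sub A : subgroup (@gen G A).
Proof.
split; [by move=> H [h _]|split].
  by move=> x y hx hy H hH hA; apply: subM => //; [apply: hx|apply: hy].
by move=> x hx H hH hA; apply: subV => //; apply: hx.
Qed.

Lemma gen_in A x : A x -> @gen G A x.
Proof. by move=> hx H _; apply. Qed.

Lemma gen_min A H : subgroup H -> subset A H -> subset (@gen G A) H.
Proof. by move=> hH hA x; apply. Qed.

Lemma gen_mono A B : subset A B -> subset (@gen G A) (@gen G B).
Proof. by move=> h; apply: gen_min; [apply: gen_sub|move=> x /h; apply: gen_in]. Qed.

Lemma gen_normalized S A : subgroup S -> normalized S A -> normalized S (gen A).
Proof.
move=> hS h s n hs; move: n.
suff : subset (gen A) (fun n => gen A (s * n * s^-1)) by [].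
apply: gen_min; last by move=> x hx; apply: gen_in; apply: h.
split; [|split].
- by gsimp; apply: sub1; apply: gen_sub.
- by move=> x y hx hy; have := subM (gen_sub A) hx hy; gsimp.
- by move=> x hx; have := subV (gen_sub A) hx; gsimp.
Qed.

End Cong.

(** * Finite covers by the classes of a relation, and the pigeonhole principle *)

Section Fincov.
Definition fincov (X : Type) (P : X -> Prop) (E : X -> X -> Prop) :=
  exists l : list X, (forall r, In r l -> P r) /\ forall x, P x -> exists r, In r l /\ E r x.

Definition per (X : Type) (E : X -> X -> Prop) :=
  (forall x y, E x y -> E y x) /\ (forall x y z, E x y -> E y z -> E x z).

Variable X : Type.
Implicit Types (P : X -> Prop) (E : X -> X -> Prop).

(** The labels in [l] need not be points of [P]: a label whose class misses [P] is discarded, and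
    excluded middle supplies a point of [P] for every other one. *)
Lemma pick_reps (L : Type) (l : list L) P (E : X -> X -> Prop) (c : L -> X -> Prop) :
  (forall i x y, c i x -> c i y -> E x y) ->
  (forall x, P x -> exists i, In i l /\ c i x) -> fincov P E.
Proof.
move=> hc hl.
suff [l' [h1 h2]] : exists l' : list X, (forall r, In r l' -> P r) /\
    forall x i, P x -> In i l -> c i x -> exists r, In r l' /\ E r x.
  by exists l'; split=> // x hx; have [i [hi ci]] := hl x hx; apply: (h2 x i).
elim: l {hl} => [|i l [l' [h1 h2]]]; first by exists nil; split=> // ? ? ? [].
have [[x0 [hx0 cx0]]|no] := classic (exists x, P x /\ c i x).
  exists (x0 :: l'); split; first by move=> r [<-//|]; apply: h1.
  move=> x j hx [<-|hj] cx; first by exists x0; split; [left|apply: hc cx].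
  by have [r [? ?]] := h2 x j hx hj cx; exists r; split=> //; right.
exists l'; split=> // x j hx [ij|hj] cx; last exact: h2 cx.
by case: no; exists x; rewrite ij.
Qed.

Lemma fincov_pull (Y : Type) (Q : Y -> Prop) (R : Y -> Y -> Prop) P E (f : X -> Y) :
  per R -> fincov Q R -> (forall x, P x -> Q (f x)) ->
  (forall x y, R (f x) (f y) -> E x y) -> fincov P E.
Proof.
move=> [sR tR] [l [h1 h2]] hf hE.
apply: (@pick_reps Y l P E (fun r x => R r (f x))).
  by move=> r x y hx hy; apply: hE; apply: tR hy; apply: sR.
by move=> x /hf /h2.
Qed.

Lemma fincov_mono P E E' : (forall x y, E x y -> E' x y) -> fincov P E -> fincov P E'.
Proof.
move=> h [l [h1 h2]]; exists l; split=> // x /h2 [r [? ?]].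
by exists r; split=> //; apply: h.
Qed.

Lemma fincov_sub P Q E : per E -> (forall x, P x -> Q x) -> fincov Q E -> fincov P E.
Proof. by move=> pE h hQ; apply: (fincov_pull (f := fun x => x)) pE hQ h _. Qed.

Lemma fincov_and P E1 E2 : per E1 -> per E2 -> fincov P E1 -> fincov P E2 ->
  fincov P (fun x y => E1 x y /\ E2 x y).
Proof.
move=> [s1 t1] [s2 t2] [l1 [_ h1]] [l2 [_ h2]].
apply: (@pick_reps _ (list_prod l1 l2) P _ (fun p x => E1 (fst p) x /\ E2 (snd p) x)).
  move=> [a b] x y /= [? ?] [? ?]; split; [apply: (t1 x a y)|apply: (t2 x b y)] => //; [exact: s1|exact: s2].
move=> x hx; have [a [? ?]] := h1 x hx; have [b [? ?]] := h2 x hx.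
by exists (a, b); split=> //; apply/in_prod_iff.
Qed.

Lemma pigeon (l : list X) E (u : nat -> X) : per E ->
  (forall i, exists r, In r l /\ E r (u i)) -> exists i j, i < j /\ E (u i) (u j).
Proof.
move=> [sE tE]; elim: l u => [|r l IH] u h; first by case: (h 0) => ? [].
have [[i hi]|no] := classic (exists i, E r (u i)); last first.
  apply: IH => i; have [r' [[e|?] er]] := h i; first by case: no; exists i; rewrite e.
  by exists r'.
have [[j [ij hj]]|no] := classic (exists j, i < j /\ E r (u j)).
  by exists i, j; split=> //; apply: tE hj; apply: sE.
have [k|a [b [ab hab]]] := IH (fun k => u (Datatypes.S i + k)).
  have [r' [[e|?] er]] := h (Datatypes.S i + k); last by exists r'.
  by case: no; exists (Datatypes.S i + k); rewrite e; split=> //; lia.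
by exists (Datatypes.S i + a), (Datatypes.S i + b); split=> //; lia.
Qed.
End Fincov.

Section Index.
Variable G : group.
Implicit Types (x y z : G) (S N D K : G -> Prop).

Lemma cong_per N : subgroup N -> per (cong N).
Proof. by move=> h; split=> [x y|x y z]; [apply: cong_sym|apply: cong_trans]. Qed.

Lemma FIN_I S N : subgroup N -> subset N S -> normalized S N -> fincov S (cong N) -> FIN S N.
Proof. by []. Qed.

Lemma FIN_sub S N : FIN S N -> subgroup N. Proof. by case. Qed.
Lemma FIN_in S N : FIN S N -> subset N S. Proof. by case=> _ []. Qed.
Lemma FIN_norm S N : FIN S N -> normalized S N. Proof. by case=> _ [_ []]. Qed.
Lemma FIN_cov S N : FIN S N -> fincov S (cong N). Proof. by case=> _ [_ []]. Qed.

Lemma FIN_refl S : subgroup S -> FIN S S.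
Proof.
move=> h; apply: FIN_I => //; first by move=> s n hs hn; apply: subM; [|apply: subM|apply: subV].
exists (gone :: nil); split=> [r [<-|[]]|x hx]; first exact: sub1.
by exists gone; split; [left|rewrite cong_1].
Qed.

Lemma FIN_mono S N D : subgroup D -> normalized S D -> subset D S -> subset N D -> FIN S N -> FIN S D.
Proof.
move=> hD nD DS ND hN; apply: FIN_I => //.
by apply: (fincov_mono _ (FIN_cov hN)) => x y; apply: cong_mono.
Qed.

Lemma FIN_inter S N D : FIN S N -> FIN S D -> FIN S (interP N D).
Proof.
move=> hN hD; have sN := FIN_sub hN; have sD := FIN_sub hD.
apply: FIN_I; first exact: inter_sub.
- by move=> x [/(FIN_in hN)].
- by apply: inter_normalized; apply: FIN_norm.
- exact: (fincov_and (cong_per sN) (cong_per sD) (FIN_cov hN) (FIN_cov hD)).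
Qed.

End Index.

(** * Polycyclic subgroups *)

Section Powers.
Variable G : group.
Implicit Types (x y : G) (S N D K : G -> Prop).

Definition zpow x (z : Z) : G :=
  match z with
  | Z0 => gone
  | Zpos p => gpow x (Pos.to_nat p)
  | Zneg p => (gpow x (Pos.to_nat p))^-1
  end.

Arguments gpow : simpl never.

Lemma gpow0 x : gpow x 0 = gone. Proof. by []. Qed.
Lemma gpowS x n : gpow x (Datatypes.S n) = x * gpow x n. Proof. by []. Qed.

Lemma gpowD x m n : gpow x (m + n) = gpow x m * gpow x n.
Proof. by elim: m => [|m IH]; rewrite ?gmul1l // Nat.add_succ_l !gpowS IH gmulA. Qed.

Lemma gpowSr x n : gpow x (Datatypes.S n) = gpow x n * x.
Proof. by rewrite -Nat.add_1_r gpowD gpowS gpow0 gmul1r. Qed.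

Lemma gpowM x m n : gpow x (m * n)%nat = gpow (gpow x m) n.
Proof.
elim: n => [|n IH]; first by rewrite Nat.mul_0_r.
by rewrite Nat.mul_succ_r Nat.add_comm gpowD IH.
Qed.

Lemma gpow1 n : gpow (gone : G) n = gone.
Proof. by elim: n => //= n IH; rewrite gpowS IH gmul1l. Qed.

Lemma gpow_conj s x n : gpow (s * x * s^-1) n = s * gpow x n * s^-1.
Proof.
elim: n => [|n IH]; first by rewrite gpow0; grp.
by rewrite !gpowS IH; grp.
Qed.

Lemma zpow_nat x n : zpow x (Z.of_nat n) = gpow x n.
Proof. by case: n => // n; rewrite /zpow /= SuccNat2Pos.id_succ. Qed.

Lemma zpow_oppnat x n : zpow x (- Z.of_nat n) = (gpow x n)^-1.
Proof. by case: n => [|n]; rewrite /zpow /= ?ginv1 // SuccNat2Pos.id_succ. Qed.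

Lemma zpow_succ x (z : Z) : zpow x (Z.succ z) = x * zpow x z.
Proof.
have [z0|z0] := Z_le_gt_dec 0 z.
  by rewrite -(Z2Nat.id z z0) -Nat2Z.inj_succ !zpow_nat.
have -> : z = (- Z.of_nat (Datatypes.S (Z.to_nat (- z - 1))))%Z by lia.
rewrite zpow_oppnat; set n := Z.to_nat _.
have -> : Z.succ (- Z.of_nat (Datatypes.S n)) = (- Z.of_nat n)%Z by lia.
by rewrite zpow_oppnat gpowSr ginvM gmulK.
Qed.

Lemma zpow_pred x (z : Z) : zpow x (Z.pred z) = x^-1 * zpow x z.
Proof. by rewrite -{2}(Z.succ_pred z) zpow_succ gmulVK. Qed.

Lemma zpow_add x a b : zpow x (a + b) = zpow x a * zpow x b.
Proof.
elim/Z.peano_ind: a => [|a IH|a IH]; first by rewrite gmul1l.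
  by rewrite Z.add_succ_l !zpow_succ IH gmulA.
by rewrite Z.add_pred_l !zpow_pred IH gmulA.
Qed.

Lemma zpow_opp x a : zpow x (- a) = (zpow x a)^-1.
Proof. by apply: (@gmulI _ (zpow x a)); rewrite gmulVr -zpow_add Z.add_opp_diag_r. Qed.

Lemma zpow_1 x : zpow x 1 = x. Proof. by rewrite /zpow /= gpowS gmul1r. Qed.

Lemma zpow_mul x a b : zpow x (a * b) = zpow (zpow x a) b.
Proof.
elim/Z.peano_ind: b => [|b IH|b IH]; first by rewrite Z.mul_0_r.
  by rewrite Z.mul_succ_r Z.add_comm zpow_add zpow_succ IH.
have -> : (a * Z.pred b = - a + a * b)%Z by lia.
by rewrite zpow_add IH zpow_opp zpow_pred.
Qed.

Lemma sub_gpow S x n : subgroup S -> S x -> S (gpow x n).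
Proof. by move=> h hx; elim: n => [|n IH]; [apply: sub1|rewrite gpowS; apply: subM]. Qed.

Lemma sub_zpow S x a : subgroup S -> S x -> S (zpow x a).
Proof.
by move=> h hx; case: a => [|p|p] /=; [exact: sub1|exact: sub_gpow|apply: subV => //; exact: sub_gpow].
Qed.

Lemma cong_gpow S N x y n : subgroup S -> subgroup N -> normalized S N -> S x -> S y ->
  cong N x y -> cong N (gpow x n) (gpow y n).
Proof.
move=> hS hN nN hx hy h; elim: n => [|n IH]; first exact: cong_refl.
by rewrite !gpowS; apply: (cong_mul hS) => //; apply: sub_gpow.
Qed.

Lemma cong_zpow S N x y a : subgroup S -> subgroup N -> normalized S N -> S x -> S y ->
  cong N x y -> cong N (zpow x a) (zpow y a).
Proof.
move=> hS hN nN hx hy h; case: a => [|p|p] /=; first exact: cong_refl.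
  exact: (cong_gpow _ hS).
by apply: (cong_inv hS) => //; [apply: sub_gpow|apply: (cong_gpow _ hS)].
Qed.

Lemma cong_gpowM S N x y n : subgroup S -> subgroup N -> normalized S N -> S x -> S y ->
  cong N (x * y) (y * x) -> cong N (gpow (x * y) n) (gpow x n * gpow y n).
Proof.
move=> hS hN nN hx hy h.
have c k : cong N (gpow x k * y) (y * gpow x k).
  elim: k => [|k IH]; first by rewrite gpow0; gsimp; apply: cong_refl.
  rewrite !gpowS -!gmulA; apply: (@cong_trans _ _ (x * (y * gpow x k))) => //.
    exact: cong_mull.
  by rewrite !gmulA; apply: (cong_mul hS) => //; [apply: sub_gpow|apply: cong_refl].
elim: n => [|n IH]; first by rewrite !gpow0 gmul1l; apply: cong_refl.
rewrite !gpowS -!gmulA.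
apply: (@cong_trans _ _ (x * (y * (gpow x n * gpow y n)))) => //; first by do 2 apply: cong_mull.
apply: cong_mull; rewrite !gmulA; apply: (cong_mul hS) => //; first exact: sub_gpow.
  exact: cong_sym.
exact: cong_refl.
Qed.

(** The verbal subgroup of m-th powers. It is normalized by whatever normalizes [S], and for
    polycyclic [S] it has finite index and these subgroups are cofinal ([polycyclic_powers],
    [fin_powers]). The inductive wrapper keeps the impredicative [gen] from unfolding. *)
Inductive powers (m : nat) S (z : G) : Prop :=
  powers_gen : gen (fun z => exists x, S x /\ z = gpow x m) z -> powers m S z.

Lemma powersE m S : powers m S = gen (fun z => exists x, S x /\ z = gpow x m).
Proof. by apply: pred_ext => z; split=> [[]|]. Qed.
Lemma powers_sub m S : subgroup (powers m S). Proof. rewrite powersE; exact: gen_sub. Qed.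
Lemma powers_min m S H : subgroup H -> (forall x, S x -> H (gpow x m)) -> subset (powers m S) H.
Proof. by move=> h hS; rewrite powersE; apply: gen_min => // _ [x [? ->]]; apply: hS. Qed.
Lemma powers_in m S : subgroup S -> subset (powers m S) S.
Proof. by move=> h; apply: powers_min => // x; apply: sub_gpow. Qed.
Lemma powers_pow m S x : S x -> powers m S (gpow x m).
Proof. by move=> h; rewrite powersE; apply: gen_in; exists x. Qed.
Lemma powers_normalized T m S : subgroup T -> normalized T S -> normalized T (powers m S).
Proof.
move=> hT h; rewrite powersE; apply: gen_normalized => // s _ hs [x [hx ->]]; exists (s * x * s^-1).
by rewrite gpow_conj; split=> //; apply: h.
Qed.
Lemma normalized_self S : subgroup S -> normalized S S.
Proof. by move=> h s n hs hn; apply: subM; [|apply: subM|apply: subV]. Qed.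

Lemma powers_gz m S x a : S x -> powers m S (zpow x (Z.of_nat m * a)).
Proof. by move=> hx; rewrite zpow_mul zpow_nat; exact: (sub_zpow a (powers_sub m S) (powers_pow m hx)). Qed.

Lemma exp_pow S N x : FIN S N -> subgroup S -> S x -> exists n, (0 < n)%nat /\ N (gpow x n).
Proof.
move=> hN hS hx; have sN := FIN_sub hN; have [l [h1 h2]] := FIN_cov hN.
have [i|i [j [ij h]]] := @pigeon _ l (cong N) (fun i => gpow x i) (cong_per sN).
  by apply: h2; exact: sub_gpow.
exists (j - i)%nat; split; first lia.
move: h; rewrite /cong {1}(_ : j = (i + (j - i))%nat); first by lia.
by rewrite gpowD gmulVK.
Qed.

Lemma fin_exp S N : FIN S N -> subgroup S -> exists m, (0 < m)%nat /\ forall x, S x -> N (gpow x m).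
Proof.
move=> hN hS; have sN := FIN_sub hN; have [l [h1 h2]] := FIN_cov hN.
suff [m [m0 hm]] : exists m, (0 < m)%nat /\ forall r, In r l -> N (gpow r m).
  exists m; split=> // x hx; have [r [hr e]] := h2 x hx.
  apply: (cong_in sN _ (hm r hr)).
  by apply: (cong_gpow _ hS) => //; [apply: FIN_norm|apply: h1].
elim: l h1 {h2} => [|r l IH] h1; first by exists 1%nat; split; [lia|].
have [|m [m0 hm]] := IH; first by move=> s hs; apply: h1; right.
have [|n [n0 hn]] := exp_pow hN hS (x := r); first by apply: h1; left.
exists (n * m)%nat; split; first nia.
move=> s [<-|hs]; first by rewrite gpowM; apply: sub_gpow.
by rewrite Nat.mul_comm gpowM; apply: sub_gpow => //; apply: hm.
Qed.

Lemma fin_powers S N : FIN S N -> subgroup S -> exists m, (0 < m)%nat /\ subset (powers m S) N.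
Proof.
move=> hN hS; have [m [m0 hm]] := fin_exp hN hS; exists m; split=> //.
by apply: powers_min => //; exact: FIN_sub hN.
Qed.

End Powers.

Section Poly.
Variable G : group.
Implicit Types (x y : G) (S N D K : G -> Prop).

Definition cyc_ext D t S :=
  [/\ subgroup S, subset D S, normalized S D, S t &
      forall x, S x -> exists i, D ((zpow t i)^-1 * x)].

Inductive polycyclic : (G -> Prop) -> Prop :=
| polycyclic_triv : polycyclic (fun x => x = gone)
| polycyclic_ext D t S : polycyclic D -> cyc_ext D t S -> polycyclic S.

Lemma triv_sub : subgroup (fun x => x = gone).
Proof.
by split=> //; split=> [_ _ -> ->|_ ->]; rewrite ?ginv1 ?gmul1l.
Qed.

Lemma polycyclic_sub S : polycyclic S -> subgroup S.
Proof. by case=> [|D t S' _ [] //]; exact: triv_sub. Qed.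

Lemma cyc_comm D t S x y : subgroup D -> cyc_ext D t S -> S x -> S y -> cong D (x * y) (y * x).
Proof.
move=> sD [sS DS nD St h] hx hy; have [i hi] := h x hx; have [j hj] := h y hy.
have St' a : S (zpow t a) by apply: sub_zpow.
apply: (@cong_trans _ _ (zpow t i * zpow t j)) => //.
  by apply: cong_sym => //; apply: (cong_mul sS).
by rewrite -zpow_add Z.add_comm zpow_add; apply: (cong_mul sS).
Qed.

(** Over a cyclic extension the products [gpow t b * d] with [b < m] and [d] a representative for
    [D] suffice: Euclidean division by [m] leaves a power of [t] that is itself an m-th power. *)
Lemma polycyclic_powers S m : polycyclic S -> (0 < m)%nat -> FIN S (powers m S).
Proof.
move=> pS m0; have sS := polycyclic_sub pS.
apply: FIN_I; [exact: powers_sub|exact: powers_in|by apply: powers_normalized => //; apply: normalized_self|].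
elim: pS {sS} => [|D t S' pD IH [sS DS nD St h]].
  by exists (gone :: nil); split=> [r [<-//|[]]|x ->]; exists gone; split; [left|exact: (cong_refl gone (powers_sub m _))].
have sD := polycyclic_sub pD.
have [l [h1 h2]] := IH.
apply: (@pick_reps _ _ (list_prod (seq 0 m) l) S' _ (fun p x => cong (powers m S') (gpow t (fst p) * snd p) x)).
  by move=> p x y hx hy; exact: (cong_trans (powers_sub m _) (cong_sym (powers_sub m _) hx) hy).
move=> x hx; have [i hi] := h x hx; have [d [hd hdd]] := h2 _ hi.
have m0' : (Z.of_nat m > 0)%Z by lia.
have := Z_div_mod_eq_full i (Z.of_nat m); have := Z_mod_lt i _ m0'.
set q := (i / _)%Z; set b := (i mod _)%Z => hb ei.
exists (Z.to_nat b, d); split.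
  by apply/in_prod_iff; split=> //; apply/in_seq; lia.
rewrite /= -zpow_nat Z2Nat.id; first by lia.
have -> : x = zpow t b * (zpow t (Z.of_nat m * q) * ((zpow t i)^-1 * x)).
  by rewrite ei Z.add_comm zpow_add; grp.
apply: cong_mull; rewrite /cong.
have -> : d^-1 * (zpow t (Z.of_nat m * q) * ((zpow t i)^-1 * x)) =
  (d^-1 * zpow t (Z.of_nat m * q) * d) * (d^-1 * ((zpow t i)^-1 * x)) by grp.
apply: subM; first exact: powers_sub.
  apply: (@normalizedV _ S') => //; first by apply: powers_normalized => //; apply: normalized_self.
    by apply: DS; apply: h1.
  exact: powers_gz.
by move: hdd; apply: powers_min => [|y hy]; [exact: powers_sub|apply/powers_pow/DS].
Qed.

(** Take for [u] an element of [K] whose exponent of [t] modulo [D] is the least positive one;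
    Euclidean division shows that it generates [K] modulo [D]. If [K] has no element of positive
    exponent, inverses exclude negative ones too, so [K] lies in [D]. *)
Lemma cyc_sub D t S K : cyc_ext D t S -> subgroup D -> subgroup K -> subset K S ->
  subset K D \/ exists u j, [/\ K u, (0 < j)%Z, D ((zpow t j)^-1 * u) & cyc_ext (interP K D) u K].
Proof.
move=> [sS DS nD St h] sD sK KS.
have tS a : S (zpow t a) by apply: sub_zpow.
have [[n [u [Ku hu]]]|no] := classic (exists n, exists u, K u /\ D ((zpow t (Z.of_nat (Datatypes.S n)))^-1 * u)); last first.
{
  left=> x Kx; have [i hi] := h x (KS _ Kx).
  have [i0|[i0|i0]] := Ztrichotomy i 0.
  - case: no; exists (Z.to_nat (- i - 1)), x^-1; split; first exact: subV.
    have -> : Z.of_nat (Datatypes.S (Z.to_nat (- i - 1))) = (- i)%Z by lia.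
    rewrite zpow_opp; apply: subVr => //.
    by have := nD _ _ (tS i) hi; gsimp.
  - by move: hi; rewrite i0 /=; gsimp.
  - by case: no; exists (Z.to_nat (i - 1)), x; split=> //; have -> : Z.of_nat (Datatypes.S (Z.to_nat (i - 1))) = i by lia.
}
have [n0 [[u0 [Ku0 hu0]] hmin]] : exists n0, (exists u, K u /\ D ((zpow t (Z.of_nat (Datatypes.S n0)))^-1 * u)) /\
   forall k, (k < n0)%nat -> ~ (exists u, K u /\ D ((zpow t (Z.of_nat (Datatypes.S k)))^-1 * u)).
{ elim/lt_wf_ind: n u Ku hu => n IH u Ku hu.
  have [[k [kn [v [Kv hv]]]]|nok] := classic (exists k, (k < n)%nat /\ exists v, K v /\ D ((zpow t (Z.of_nat (Datatypes.S k)))^-1 * v)).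
    exact: (IH k kn v).
  by exists n; split; [exists u|move=> k kn hk; apply: nok; exists k]. }
right; set j := Z.of_nat (Datatypes.S n0) in hu0.
have j0 : (j > 0)%Z by rewrite /j; lia.
exists u0, j; split=> //.
split=> //.
- by move=> x [].
- move=> s x Ks [Kx Dx]; split; first by apply: subM; [|apply: subM|apply: subV].
  by apply: nD => //; apply: KS.
- move=> x Kx; have [i hi] := h x (KS _ Kx).
have := Z_div_mod_eq_full i j; have := Z_mod_lt i _ j0.
set q := (i / _)%Z; set b := (i mod _)%Z => hb ei.
exists q; set y := (zpow u0 q)^-1 * x.
have Ky : K y.
  by apply: subM => //; apply: subV => //; apply: sub_zpow.
have hy : D ((zpow t b)^-1 * y).
  have -> : b = (- (j * q) + i)%Z by lia.
  rewrite zpow_add zpow_opp /y; apply: (cong_mul sS) => //.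
  apply: (cong_inv sS) => //; rewrite zpow_mul; apply: (cong_zpow _ sS) => //.
  exact: KS.
split=> //; have [b0|b0] := Z.eq_dec b 0; first by move: hy; rewrite b0 /=; gsimp.
case: (hmin (Z.to_nat (b - 1))); first lia.
by exists y; split=> //; have -> : Z.of_nat (Datatypes.S (Z.to_nat (b - 1))) = b by lia.
Qed.

Lemma polycyclic_subgroup S K : polycyclic S -> subgroup K -> subset K S -> polycyclic K.
Proof.
move=> pS; elim: pS K => [|D t S' pD IH hc] K sK KS.
  have -> : K = fun x => x = gone; last exact: polycyclic_triv.
  by apply: pred_ext => x; split=> [/KS|->] //; apply: sub1.
have sD := polycyclic_sub pD.
have [KD|[u [j [Ku j0 hu hK]]]] := cyc_sub hc sD sK KS; first exact: IH.
apply: polycyclic_ext hK; apply: IH; first exact: inter_sub.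
by move=> x [].
Qed.

Lemma polycyclic_fg S : polycyclic S -> exists l, S = gen (fun x => In x l).
Proof.
elim=> [|D t S' pD [l el] [sS DS nD St h]].
  exists nil; apply: pred_ext => x; split=> [->|]; first exact: (sub1 (gen_sub _)).
  by move=> h; apply: (h (fun x => x = gone)) => //; exact: triv_sub.
exists (t :: l); apply: pred_ext => x; split; last first.
  move=> hx; apply: (hx S') => // y [<-//|hy]; apply: DS; rewrite el; exact: gen_in.
move=> hx; have [i hi] := h x hx; rewrite -(gmulK (zpow t i) x); refine (subM (gen_sub _) _ _).
  by refine (sub_zpow _ (gen_sub _) _); apply: gen_in; left.
by move: hi; rewrite {1}el => hi; apply: (gen_mono _ hi) => y hy; right.
Qed.

End Poly.

(** * Subgroup separability of polycyclic groups *)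

Section Cent.
Variable G : group.
Implicit Types (x y : G) (S N D K : G -> Prop).

Lemma commV x y : (comm x y)^-1 = comm y x. Proof. by grp. Qed.

Lemma cent_l S N d : subgroup S -> subgroup N -> normalized S N -> S d ->
  subgroup (fun x => S x /\ N (comm x d)).
Proof.
move=> sS sN nN Sd; split; [|split].
- by split; [exact: sub1|rewrite /comm; gsimp; exact: sub1].
- move=> x y [Sx Nx] [Sy Ny]; split; first exact: subM.
  have -> : comm (x * y) d = y^-1 * comm x d * y * comm y d by grp.
  by apply: subM => //; apply: (normalizedV sS).
- move=> x [Sx Nx]; split; first exact: subV.
  have -> : comm x^-1 d = x * (comm x d)^-1 * x^-1 by grp.
  by apply: nN => //; apply: subV.
Qed.

Lemma cent_r S N x : subgroup S -> subgroup N -> normalized S N -> S x ->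
  subgroup (fun d => S d /\ N (comm x d)).
Proof.
move=> sS sN nN Sx; have [h1 [h2 h3]] := cent_l sS sN nN Sx.
have E d : N (comm x d) <-> N (comm d x).
  by split=> /(subV sN); rewrite commV.
have -> : (fun d => S d /\ N (comm x d)) = (fun d => S d /\ N (comm d x)) by apply: pred_ext => d; rewrite E.
by [].
Qed.

Lemma normal_comm S N x n : subgroup S -> subgroup N -> normalized S N -> S x -> N n -> N (comm x n).
Proof.
move=> sS sN nN Sx Nn; have -> : comm x n = x^-1 * n^-1 * x * n by grp.
by apply: subM => //; apply: (normalizedV sS) => //; apply: subV.
Qed.

End Cent.

Section Separability.
Variable G : group.
Implicit Types (x y : G) (S N D K : G -> Prop).

(* Powers of [u] act on [D] by permutations of the finite set [D/N], so some [u^e1] centralises [D/N];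
   the commutators [comm (u^e1) s] then lie in [D] and die after raising to the exponent of [D/N]. *)
Lemma central_power S D t N u : subgroup D -> cyc_ext D t S -> FIN D N -> normalized S N -> S u ->
  exists e, (0 < e)%nat /\ forall s, S s -> N (comm (gpow u e) s).
Proof.
move=> sD hc fN nN Su; have [sS DS nD St h] := hc; have sN := FIN_sub fN.
have [l [h1 h2]] := FIN_cov fN.
have pw k : S (gpow u k) by apply: sub_gpow.
have [e1 [e10 he1]] : exists e1, (0 < e1)%nat /\ forall d, In d l -> N (comm (gpow u e1) d).
  elim: l h1 {h2} => [|d l IH] h1; first by exists 1%nat; split; [lia|].
  have [|m [m0 hm]] := IH; first by move=> s hs; apply: h1; right.
  have Dd : D d by apply: h1; left.
  have [l' [_ h2]] := FIN_cov fN.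
  have [i|i [j [ij hij]]] := @pigeon _ l' (cong N) (fun i => gpow u i * d * (gpow u i)^-1) (cong_per sN).
    by apply: h2; apply: nD.
  have cd : N (comm (gpow u (j - i)) d).
    set k := (j - i)%nat; have ej : j = (i + k)%nat by rewrite /k; lia.
    have := normalizedV sS nN (pw (i + k)%nat) hij; rewrite /cong ej gpowD.
    by rewrite /comm; gsimp.
  have cS := cent_l sS sN nN (DS _ Dd).
  exists ((j - i) * m)%nat; split; first by nia.
  move=> r [<-|hr]; first by rewrite gpowM; apply: (proj2 (sub_gpow m cS _)).
  rewrite Nat.mul_comm gpowM; apply: (proj2 (sub_gpow _ (cent_l sS sN nN _) _)); last by split=> //; apply: hm.
  by apply: DS; apply: h1; right.
have cD d : D d -> N (comm (gpow u e1) d).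
  move=> hd; have [r [hr er]] := h2 d hd.
  have Sr : S r by apply: DS; apply: h1.
  have cS := cent_r sS sN nN (pw e1).
  rewrite -(gmulK r d); apply: (proj2 (subM cS _ _)); first by split=> //; apply: he1.
  by split; [apply: subM => //; [apply: subV|apply: DS]|apply: (normal_comm sS)].
have [q [q0 hq]] := fin_exp fN sD.
exists (e1 * q)%nat; split; first by nia.
move=> s Ss; rewrite gpowM; set v := gpow u e1.
have Dc : D (comm v s).
  by have := cyc_comm sD hc Ss (pw e1); rewrite /cong /comm /v; gsimp.
set c := comm v s in Dc.
have -> : comm (gpow v q) s = (gpow v q)^-1 * gpow (v * c) q.
  have -> : v * c = s^-1 * v * s^-1^-1 by rewrite /c; grp.
  by rewrite gpow_conj; grp.
have Sc : S c by apply: DS.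
apply: (@cong_trans _ _ (gpow v q * gpow c q)) => //.
  by rewrite /cong gmulVK; apply: hq.
apply: cong_sym => //; apply: (cong_gpowM _ sS) => //; first exact: pw.
have := subV sN (cD c Dc); rewrite commV /cong /comm -/v.
by gsimp.
Qed.

Definition cyc_prod u N : G -> Prop := fun x => exists a, N ((zpow u a)^-1 * x).

Lemma cyc_prod_sub S N w : subgroup S -> subgroup N -> normalized S N -> S w -> subgroup (cyc_prod w N).
Proof.
move=> sS sN nN Sw; have Swa a : S (zpow w a) by apply: sub_zpow.
split; [|split].
- by exists 0%Z; rewrite /=; gsimp; exact: sub1.
- move=> x y [a ha] [b hb]; exists (a + b)%Z; rewrite zpow_add.
  by apply: (cong_mul sS).
- by move=> x [a ha]; exists (- a)%Z; rewrite zpow_opp; apply: (cong_inv sS).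
Qed.

(** Extends a finite-index subgroup [N] of [D] to one of [S]. Since [S/D] may be infinite, a power
    of [u] has to be adjoined; it is chosen central modulo [N], which makes the result normal, and
    [0 < j] makes the index finite. *)
Lemma cyc_FIN S D t N u j : subgroup D -> cyc_ext D t S -> FIN D N -> normalized S N -> S u ->
  (0 < j)%Z -> D ((zpow t j)^-1 * u) -> exists e, (0 < e)%nat /\ FIN S (cyc_prod (gpow u e) N).
Proof.
move=> sD hc fN nN Su j0 hu; have [e [e0 he]] := central_power sD hc fN nN Su.
exists e; split=> //; set w := gpow u e.
have [sS DS nD St h] := hc; have sN := FIN_sub fN; have ND := FIN_in fN.
have Sw : S w by apply: sub_gpow.
have Swa a : S (zpow w a) by apply: sub_zpow.
have cw a s : S s -> N (comm (zpow w a) s).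
  by move=> Ss; apply: (proj2 (sub_zpow a (cent_l sS sN nN Ss) _)); split=> //; apply: he.
have sM : subgroup (cyc_prod w N) by exact: (cyc_prod_sub sS).
apply: FIN_I => //.
  by move=> x [a ha]; rewrite -(gmulK (zpow w a) x); apply: subM => //; apply/DS/ND.
  move=> s x Ss [a ha]; exists a.
  have -> : (zpow w a)^-1 * (s * x * s^-1) = comm (zpow w a) s^-1 * (s * ((zpow w a)^-1 * x) * s^-1) by grp.
  by apply: subM => //; [apply: cw; apply: subV|apply: nN].
have [l [h1 h2]] := FIN_cov fN.
(* Modulo [D], [w] is [zpow t J], so exponents of [t] only matter modulo [J]. *)
set J := (j * Z.of_nat e)%Z.
have J0 : (J > 0)%Z by rewrite /J; nia.
apply: (@pick_reps _ _ (list_prod (seq 0 (Z.to_nat J)) l) S _ (fun p => cong (cyc_prod w N) (gpow t (fst p) * snd p))).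
  by move=> p x y hx hy; apply: cong_trans hy => //; apply: cong_sym.
move=> x Sx; have [i hi] := h x Sx.
have := Z_div_mod_eq_full i J; have := Z_mod_lt i J J0.
set q := (i / J)%Z; set b := (i mod J)%Z => hb ei.
set d := (zpow w q)^-1 * zpow t (J * q) * ((zpow t i)^-1 * x).
have Dd : D d.
  apply: subM => //; rewrite zpow_mul; apply: (cong_zpow _ sS) => //; first by apply: sub_zpow.
  rewrite /J zpow_mul zpow_nat; apply: (cong_gpow _ sS) => //; first by apply: sub_zpow.
  by apply: cong_sym.
have [r [hr er]] := h2 d Dd.
exists (Z.to_nat b, r); split.
  by apply/in_prod_iff; split=> //; apply/in_seq; lia.
exists q; rewrite /= -zpow_nat Z2Nat.id; first by lia.
have -> : (zpow w q)^-1 * ((zpow t b * r)^-1 * x) = comm (zpow w q) r * (r^-1 * d).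
  by rewrite /d /comm ei Z.add_comm zpow_add; gsimp.
by apply: subM => //; apply: cw; apply: DS; apply: h1.
Qed.

(** If [K] has an element [u] of positive exponent, either [g] is outside [K D] and a subgroup above
    [D] separates, or [g] can be moved into [D] and the induction applies to the intersection of [K]
    and [D]. Otherwise [K] lies in [D] and [S/D] is infinite cyclic; [g] is then separated inside
    [D] or by its exponent of [t]. *)
Lemma subgroup_separable S K g : polycyclic S -> subgroup K -> subset K S -> S g -> ~ K g ->
  exists N, FIN S N /\ forall k n, K k -> N n -> g <> k * n.
Proof.
move=> pS; elim: pS K g => [|D t S' pD IH hc] K g sK KS Sg Kg.
  by case: Kg; rewrite Sg; apply: sub1.
have sD := polycyclic_sub pD; have [sS DS nD St h] := hc.
have Pn m : normalized S' (powers m D) by apply: powers_normalized.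
have fD := FIN_refl sD.
have tS a : S' (zpow t a) by apply: sub_zpow.
have [[u [j [Ku j0 hu]]]|no] := classic (exists u j, [/\ K u, (0 < j)%Z & D ((zpow t j)^-1 * u)]).
  have Su := KS _ Ku.
  have [[k0 [Kk0 Dk]]|nk] := classic (exists k, K k /\ D (k^-1 * g)); last first.
    have [e [e0 fM]] := cyc_FIN sD hc fD nD Su j0 hu.
    exists (cyc_prod (gpow u e) D); split=> // k n Kk [a ha] eg; apply: nk.
    exists (k * zpow (gpow u e) a); split; last by rewrite eg; gsimp.
    by apply: subM => //; apply: sub_zpow => //; apply: sub_gpow.
  set g' := k0^-1 * g in Dk.
  have nKg' : ~ interP K D g'.
    by move=> [Kg' _]; apply: Kg; rewrite -(gmulK k0 g); apply: subM.
  have [|N1 [fN1 hN1]] := IH (interP K D) g' (inter_sub sK sD) _ Dk nKg'; first by move=> x [].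
  (* [N1] is normal in [D] only, whereas [powers m D] is normalized by [S']. The power of [u]
     adjoined next lies in [K], so it can be absorbed into the factor [k]. *)
  have [m [m0 hm]] := fin_powers fN1 sD.
  have [e [e0 fM]] := cyc_FIN sD hc (polycyclic_powers pD m0) (Pn m) Su j0 hu.
  exists (cyc_prod (gpow u e) (powers m D)); split=> // k n Kk [a ha] eg.
  set ua := zpow (gpow u e) a in ha.
  apply: (hN1 (k0^-1 * k * ua) (ua^-1 * n)); last by rewrite /g' eg; grp.
    split.
      apply: subM => //; first by apply: subM => //; apply: subV.
      by apply: sub_zpow => //; apply: sub_gpow.
    apply: (subMr (y := ua^-1 * n)) => //; first by apply: (powers_in sD ha).
    by move: Dk; rewrite /g' eg; gsimp.
  exact: hm.
have KD : subset K D.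
  by have [//|[u [j [Ku j0 hu _]]]] := cyc_sub hc sD sK KS; case: no; exists u, j.
(* The identity of [K] is already a forbidden witness, so [no] makes [t] of infinite order modulo
   [D]. *)
have nt j : j <> 0%Z -> ~ D (zpow t j).
  move=> j0 hj; apply: no; exists gone.
  have [?|?] : (0 < j)%Z \/ (0 < - j)%Z by lia.
    by exists j; split=> //; [exact: sub1|rewrite gmul1r; apply: subV].
  by exists (- j)%Z; split=> //; [exact: sub1|rewrite gmul1r zpow_opp ginvK].
have [Dg|nDg] := classic (D g).
  have [N1 [fN1 hN1]] := IH K g sK KD Dg Kg.
  have [m [m0 hm]] := fin_powers fN1 sD.
  have [//||e [e0 fM]] := cyc_FIN (u := t) (j := 1%Z) sD hc (polycyclic_powers pD m0) (Pn m) St.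
    by rewrite zpow_1 gmulVl; exact: sub1.
  exists (cyc_prod (gpow t e) (powers m D)); split=> // k n Kk [a ha] eg.
  have : D (zpow t (Z.of_nat e * a)).
    rewrite zpow_mul zpow_nat; have Dn : D n by apply: (subMl (x := k)) => //; [apply: KD|rewrite -eg].
    by have := powers_in sD ha => /(subMr sD Dn) /(subVr sD).
  have [a0 _|/nt//] := Z.eq_dec (Z.of_nat e * a) 0.
  have {}a0 : a = 0%Z by nia.
  by apply: (hN1 k n) => //; apply: hm; move: ha; rewrite a0 /=; gsimp.
have [b hb] := h g Sg.
have b0 : b <> 0%Z by move=> b0; apply: nDg; move: hb; rewrite b0 /=; gsimp.
(* Any [j] larger than [|b|] works: a nonzero [b] is then not a multiple of [j], and the powers of
   [zpow t j] miss the class of [g] modulo [D]. *)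
set j := (Z.abs b + 1)%Z.
have [||e [e0 fM]] := cyc_FIN (u := zpow t j) (j := j) sD hc fD nD (tS j).
  by rewrite /j; lia.
  by rewrite gmulVl; exact: sub1.
exists (cyc_prod (gpow (zpow t j) e) D); split=> // k n Kk [a ha] eg.
apply: (nt (- b + j * Z.of_nat e * a)%Z).
{ rewrite -Z.mul_assoc /j; move: (Z.of_nat e * a)%Z => c hc'.
  have [?|[?|?]] : (c = 0 \/ 1 <= c \/ c <= -1)%Z by lia.
  - by subst c; lia.
  - by have : (Z.abs b + 1 <= (Z.abs b + 1) * c)%Z by [nia]; lia.
  - by have : ((Z.abs b + 1) * c <= - (Z.abs b + 1))%Z by [nia]; lia. }
rewrite zpow_add zpow_opp !zpow_mul zpow_nat; set v := zpow _ a in ha *.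
apply: (subMr (y := v^-1 * (k^-1 * g))) => //.
  by rewrite eg gmulVK.
have -> : (zpow t b)^-1 * v * (v^-1 * (k^-1 * g)) = ((zpow t b)^-1 * k^-1 * (zpow t b)) * ((zpow t b)^-1 * g) by grp.
by apply: subM => //; apply: (normalizedV sS) => //; apply: subV => //; apply: KD.
Qed.

Lemma subgroup_closed K g : polycyclic (@whole G) -> subgroup K ->
  (forall N, FING N -> prodP K N g) -> K g.
Proof.
move=> pG sK h; apply: NNPP => nK.
have [//|//|N [fN hN]] := subgroup_separable pG sK _ _ nK.
by have [k [n [Kk [Nn e]]]] := h N fN; apply: (hN k n).
Qed.

(** Finitely many cosets [r K] cover [D]. Separating [r^-1] from [K] gives a finite-index subgroup
    that misses [r K], and the intersection over all [r] outside [K] works. *)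
Lemma finite_index_separable D K : polycyclic (@whole G) -> subgroup K -> fincov D (cong K) ->
  exists N, FING N /\ subset (interP N D) K.
Proof.
move=> pG sK [l [_ h]].
suff [N [fN hN]] : exists N, FING N /\ forall r x, In r l -> N x -> cong K r x -> K r.
  exists N; split=> // x [Nx Dx]; have [r [hr er]] := h x Dx.
  exact: (cong_in sK er (hN r x hr Nx er)).
elim: l {h} => [|r l [N [fN hN]]]; first by exists (@whole G); split=> //; apply: FIN_refl.
have [Kr|nKr] := classic (K r).
  by exists N; split=> // s x [<-//|hs]; apply: hN.
have [//|||N' [fN' hN']] := subgroup_separable (g := r^-1) pG sK => //; first by move=> /(subVr sK).
exists (interP N N'); split; first exact: FIN_inter.
move=> s x [<-|hs] [Nx N'x] er; last exact: (hN s x).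
case: (hN' (r^-1 * x) x^-1) => //; last by grp.
by apply: subV => //; exact: FIN_sub fN'.
Qed.

End Separability.

(** * The lower central series of a finitely generated nilpotent group *)

(* An inductive copy of [lcs], which does not reduce to the impredicative [gen]. *)
Inductive gam (G : group) (n : nat) (x : G) : Prop := gam_lcs : lcs n x -> gam n x.

Section Gam.
Variable G : group.
Implicit Types (x y a b : G) (S N D K : G -> Prop).
Local Notation full := (@whole G).
Local Notation gam := (@gam G).

Lemma gam0 x : gam 0 x. Proof. by []. Qed.

Lemma gamS n : gam (Datatypes.S n) = gen (fun z => exists a b, gam n a /\ z = comm a b).
Proof.
apply: pred_ext => x; split=> [[h]|h].
  by apply: (gen_mono _ h) => z [a [b [? ?]]]; exists a, b.
by split; apply: (gen_mono _ h) => z [a [b [[?] ?]]]; exists a, b.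
Qed.

Lemma gam_sub n : subgroup (gam n).
Proof. by case: n => [//|n]; rewrite gamS; exact: gen_sub. Qed.
Hint Resolve gam_sub : core.

Lemma gam_comm n a b : gam n a -> gam (Datatypes.S n) (comm a b).
Proof. by move=> h; rewrite gamS; apply: gen_in; exists a, b. Qed.

Lemma gam_min n H : subgroup H -> (forall a b, gam n a -> H (comm a b)) -> subset (gam (Datatypes.S n)) H.
Proof. by move=> sH h; rewrite gamS; apply: gen_min => // _ [a [b [? ->]]]; apply: h. Qed.

Lemma comm_conj s a b : s * comm a b * s^-1 = comm (s * a * s^-1) (s * b * s^-1).
Proof. by grp. Qed.

Lemma gam_normal n : normalized full (gam n).
Proof.
elim: n => [//|n IH]; rewrite gamS; apply: gen_normalized => // s _ hs [a [b [ha ->]]].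
by exists (s * a * s^-1), (s * b * s^-1); rewrite comm_conj; split=> //; apply: IH.
Qed.
Hint Resolve gam_normal : core.

Lemma gam_normalized S n : normalized S (gam n).
Proof. by move=> s x _; apply: gam_normal. Qed.
Hint Resolve gam_normalized : core.

Lemma gam_conj n s x : gam n x -> gam n (s * x * s^-1).
Proof. by move=> h; apply: gam_normal. Qed.

Lemma gam_conjV n s x : gam n x -> gam n (s^-1 * x * s).
Proof. by move=> h; apply: (normalizedV (S := full)). Qed.

Lemma gam_dec n : subset (gam (Datatypes.S n)) (gam n).
Proof.
apply: gam_min => // a b ha; have -> : comm a b = a^-1 * (b^-1 * a * b) by grp.
by apply: subM => //; [apply: subV|apply: gam_conjV].
Qed.

Lemma gam_le m n : (m <= n)%nat -> subset (gam n) (gam m).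
Proof. by elim: n / => // n _ IH x hx; apply/IH/gam_dec. Qed.

Lemma gam_commr n a b : gam n b -> gam (Datatypes.S n) (comm a b).
Proof. by move=> h; rewrite -commV; apply: subV => //; apply: gam_comm. Qed.

(* Hall-Witt *)
Lemma gam_comm1 n a b : gam n a -> gam 1 b -> gam (Datatypes.S (Datatypes.S n)) (comm a b).
Proof.
move=> ha hb; move: b hb.
have sc := cent_r (whole_sub G) (gam_sub (Datatypes.S (Datatypes.S n))) (@gam_normal _) (x := a) I.
suff : subset (gam 1) (fun b => full b /\ gam (Datatypes.S (Datatypes.S n)) (comm a b)).
  by move=> h b /h [].
apply: gam_min => // c d _; split=> //.
have -> : comm a (comm c d) =
  d^-1 * ((a^-1 * comm (comm d^-1 a^-1) c * a) * (c^-1 * comm (comm a c^-1) d^-1 * c)) * d by grp.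
apply: gam_conjV; apply: subM => //; apply: gam_conjV; apply: gam_comm; last exact: gam_comm.
by apply: gam_commr; apply: subV.
Qed.

(** A substitute for bilinearity: expanding [comm (a * z) (b * w)] shows that the error is a product
    of conjugates of the three commutators assumed to be in [N]. *)
Lemma comm_pert N a b z w : subgroup N -> normalized full N ->
  N (comm (a * z) w) -> N (comm z b) -> N (comm (comm a b) (z * w)) ->
  cong N (comm a b) (comm (a * z) (b * w)).
Proof.
move=> sN nN h1 h2 h3; set c := comm a b.
have cj s x : N x -> N (s^-1 * x * s) by move=> hx; apply: (normalizedV (S := full)).
have := subM sN (cj c _ h1) (subM sN h3 (cj w _ h2)).
by rewrite /cong /c /comm; gsimp.
Qed.

End Gam.
Global Hint Resolve gam_sub gam_normal gam_normalized : core.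

(** * Homomorphisms and the lower central series *)

Definition morph (A B : group) (f : A -> B) := forall x y, f (x * y) = f x * f y.

Section Morph.
Variables A B : group.
Implicit Types (f : A -> B) (x y : A).

Lemma morph1 f : morph f -> f gone = gone.
Proof. by move=> h; apply: (@gmulI _ (f gone)); rewrite -h gmul1l gmul1r. Qed.
Lemma morphV f x : morph f -> f x^-1 = (f x)^-1.
Proof. by move=> h; apply: (@gmulI _ (f x)); rewrite -h !gmulVr morph1. Qed.
Lemma morph_comm f x y : morph f -> f (comm x y) = comm (f x) (f y).
Proof. by move=> h; rewrite /comm !h !morphV. Qed.
Lemma morph_gpow f x n : morph f -> f (gpow x n) = gpow (f x) n.
Proof. by move=> h; elim: n => [|n IH]; rewrite ?morph1 // !gpowS h IH. Qed.

Lemma preim_sub f H : morph f -> subgroup H -> subgroup (fun x => H (f x)).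
Proof.
move=> h sH; split; [|split].
- by rewrite morph1 //; exact: sub1.
- by move=> x y hx hy; rewrite h; apply: subM.
- by move=> x hx; rewrite morphV //; apply: subV.
Qed.

Lemma im_sub f H : morph f -> subgroup H -> subgroup (fun y : B => exists x, H x /\ f x = y).
Proof.
move=> h sH; split; [|split].
- by exists gone; rewrite morph1 //; split=> //; exact: sub1.
- by move=> _ _ [x [hx <-]] [y [hy <-]]; exists (x * y); rewrite h; split=> //; apply: subM.
- by move=> _ [x [hx <-]]; exists x^-1; rewrite morphV //; split=> //; apply: subV.
Qed.

Lemma equalizer_sub f f' N : morph f -> morph f' -> subgroup N -> normalized (@whole B) N ->
  subgroup (fun x => cong N (f x) (f' x)).
Proof.
move=> h h' sN nN; split; [|split].
- by rewrite !morph1 //; apply: cong_refl.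
- by move=> x y hx hy; rewrite h h'; apply: (cong_mul (whole_sub B)).
- by move=> x hx; rewrite !morphV //; apply: (cong_inv (whole_sub B)).
Qed.

Lemma morph_gam f n x : morph f -> gam n x -> gam n (f x).
Proof.
move=> h; elim: n x => [//|n IH]; apply: gam_min; first exact: preim_sub.
by move=> a b /IH ha; rewrite morph_comm //; apply: gam_comm.
Qed.

Lemma surj_gam f n (y : B) : morph f -> (forall y : B, exists x, f x = y) -> gam n y ->
  exists x, gam n x /\ f x = y.
Proof.
move=> h sf; elim: n y => [|n IH]; first by move=> y _; have [x <-] := sf y; exists x.
apply: (gam_min (H := fun y : B => exists x, gam (Datatypes.S n) x /\ f x = y)); first exact: im_sub.
move=> _ b /IH [a [ha <-]]; have [b' <-] := sf b; exists (comm a b').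
by rewrite morph_comm //; split=> //; apply: gam_comm.
Qed.

(** The map induced on [gam n / gam n.+1] depends only on the one induced on abelianizations,
    because commutators are bilinear on the graded pieces. In the induction [f a] moves by an
    element of [gam n.+1] and [f b] by one of [gam 1]; the latter error is controlled by
    [gam_comm1]. *)
Lemma gam_cong f f' n x : morph f -> morph f' -> (forall x, cong (gam 1) (f x) (f' x)) ->
  gam n x -> cong (gam (Datatypes.S n)) (f x) (f' x).
Proof.
move=> h h' h1; elim: n x => [//|n IH].
apply: (gam_min (H := fun x => cong (gam (Datatypes.S (Datatypes.S n))) (f x) (f' x))).
  exact: equalizer_sub.
move=> a b ha; rewrite !morph_comm //.
have hz := IH a ha; have hw := h1 b; rewrite -(gmulK (f a) (f' a)) -(gmulK (f b) (f' b)).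
apply: comm_pert => //.
- by apply: gam_comm1 => //; rewrite gmulK; apply: morph_gam.
- exact: gam_comm.
- by apply: gam_comm; apply: gam_comm; apply: morph_gam.
Qed.

End Morph.

Section Nilpotent.
Variable G : group.
Implicit Types (x y a b : G) (S N D K : G -> Prop).
Local Notation full := (@whole G).
Local Notation gam := (@gam G).

(** Commutators of the generators found for [gam n] with the generators of the group suffice for the
    next layer. The subgroups [cent_l] and [cent_r] extend membership in [T] from generators to all
    elements, one argument of the commutator at a time. *)
Lemma gam_fg : fin_gen G -> forall n, exists l, (forall x, In x l -> gam n x) /\ forall x, gam n x -> prodP (gen (fun y => In y l)) (gam (Datatypes.S n)) x.
Proof.
move=> [l hl]; elim=> [|n [ln [h1 h2]]].
  by exists l; split=> // x _; apply: prodP_l => //; apply: hl.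
set L := map (fun p => comm (fst p) (snd p)) (list_prod ln l).
set T := prodP (gen (fun y => In y L)) (gam (Datatypes.S (Datatypes.S n))).
have hL x : In x L -> gam (Datatypes.S n) x.
  by move=> /in_map_iff [[a b] [<- /in_prod_iff [/h1 ha _]]]; apply: gam_comm.
exists L; split=> //; rewrite -/T.
have sT : subgroup T.
  by apply: prodP_sub => //; exact: gen_sub.
have T1 : subset T (gam (Datatypes.S n)).
  move=> _ [a [b [ha [hb ->]]]]; apply: subM => //; last exact: gam_dec.
  exact: (gen_min (gam_sub G _) hL ha).
have T2 : subset (gam (Datatypes.S (Datatypes.S n))) T by apply: prodP_r; exact: gen_sub.
have nT : normalized full T.
  move=> s x _ Tx; have -> : s * x * s^-1 = x * comm x s^-1 by grp.
  by apply: subM => //; apply: T2; apply: gam_comm; apply: T1.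
have c1 a b : In a ln -> T (comm a b).
  move=> ha; refine (proj2 (hl b _ (cent_r (whole_sub G) sT nT (x := a) I) _)) => b' hb'.
  split=> //; apply: prodP_l => //; apply: gen_in; apply/in_map_iff; exists (a, b'); split=> //.
  by apply/in_prod_iff.
apply: gam_min => // a b ha.
have sc := cent_l (whole_sub G) sT nT (d := b) I.
have [u [v [hu [hv ->]]]] := h2 a ha.
refine (proj2 (subM sc (x := u) (y := v) _ _)).
  by apply: (gen_min sc _ hu) => y hy; split=> //; apply: c1.
by split=> //; apply: T2; apply: gam_comm.
Qed.

Lemma polycyclic_gam n : fin_gen G -> polycyclic (gam (Datatypes.S n)) -> polycyclic (gam n).
Proof.
move=> fg pD; have [l [h1 h2]] := gam_fg fg n.
have sub_ k : subgroup (prodP (gen (fun y => In y k)) (gam (Datatypes.S n))).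
  by apply: prodP_sub => //; exact: gen_sub.
have -> : gam n = prodP (gen (fun y => In y l)) (gam (Datatypes.S n)).
  apply: pred_ext => x; split=> [|[a [b [ha [hb ->]]]]]; first exact: h2.
  by apply: subM => //; [exact: (gen_min (gam_sub G _) h1 ha)|apply: gam_dec].
elim: l h1 {h2} => [|x l IH] h1.
  have -> // : prodP (gen (fun y => In y nil)) (gam (Datatypes.S n)) = gam (Datatypes.S n).
  apply: pred_ext => x; split=> [[a [b [ha [hb ->]]]]|hx]; last by apply: prodP_r => //; exact: gen_sub.
  by apply: subM => //; apply: ha.
have h1' y : In y l -> gam n y by move=> hy; apply: h1; right.
have {}IH := IH h1'; have sD := sub_ l.
set D := prodP (gen (fun y => In y l)) _ in IH sD.
have gD : subset (gam (Datatypes.S n)) D by apply: prodP_r; exact: gen_sub.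
have Dg : subset D (gam n).
  move=> _ [a [b [ha [hb ->]]]]; apply: subM => //; last exact: gam_dec.
  exact: (gen_min (gam_sub G _) h1' ha).
(* Every subgroup between [gam n.+1] and [gam n] is normal, so the generators of the layer can be
   adjoined one by one as cyclic extensions. *)
have nD : normalized full D.
  move=> s y _ Dy; have -> : s * y * s^-1 = y * comm y s^-1 by grp.
  by apply: subM => //; apply: gD; apply: gam_comm; apply: Dg.
have sc := cyc_prod_sub (whole_sub G) sD nD (w := x) I.
apply: (polycyclic_ext IH (t := x)); split=> //.
- move=> _ [a [b [ha [hb ->]]]]; exists a, b; split=> //.
  by apply: (gen_mono _ ha) => y hy; right.
- exact: normalized_mono nD.
- by apply: prodP_l => //; apply: gen_in; left.
- move=> y [a [b [ha [hb ey]]]]; rewrite ey; suff : cyc_prod x D (a * b) by [].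
  have cD (y' : G) : D y' -> cyc_prod x D y' by move=> Dy; exists 0%Z; rewrite /=; gsimp.
apply: subM => //; last by apply/cD/gD.
  clear ey; apply: (gen_min sc _ ha) => z [<-|hz]; first by exists 1%Z; rewrite zpow_1 gmulVl; exact: sub1.
by apply: cD; apply: prodP_l => //; apply: gen_in.
Qed.

Lemma nilpotent_polycyclic : fin_gen G -> nilpotent G -> polycyclic full.
Proof.
move=> fg [c hc].
suff H k : (k <= c)%nat -> polycyclic (gam (c - k)).
  have -> : full = gam 0 by apply: pred_ext.
  by rewrite -(Nat.sub_diag c); apply: H.
elim: k => [|k IH] hk.
  rewrite Nat.sub_0_r; have -> : gam c = fun x => x = gone; last exact: polycyclic_triv.
  by apply: pred_ext => x; split=> [[h]|->]; [apply: hc|exact: sub1].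
apply: polycyclic_gam => //; have -> : Datatypes.S (c - Datatypes.S k) = (c - k)%nat by lia.
by apply: IH; lia.
Qed.

(** If [H] covers the group modulo [gam n.+1], the entries of a commutator can be replaced by
    elements of [H] at the cost of [gam n.+2], so [H] covers it modulo [gam n.+2] as well. *)
Lemma nilpotent_gen H : nilpotent G -> subgroup H -> (forall x, prodP H (gam 1) x) -> forall x, H x.
Proof.
move=> [c hc] sH h1.
suff Hn n x : prodP H (gam (Datatypes.S n)) x.
  move=> x; have [a [b [Ha [hb ->]]]] := Hn c x.
  by have [/hc ->] := gam_dec hb; rewrite gmul1r.
elim: n x => [//|n IH] x.
set N := gam (Datatypes.S (Datatypes.S n)).
have sN : subgroup N by exact: gam_sub.
have nN S : normalized S N by exact: gam_normalized.
have sP : subgroup (prodP H N) by exact: prodP_sub.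
have [a [b [Ha [hb ->]]]] := IH x; apply: subM => //; first exact: prodP_l.
move: {x a Ha} b hb; apply: (gam_min (H := prodP H N) sP) => a b _.
have [a' [z [Ha [hz ->]]]] := IH a; have [b' [w [Hb [hw ->]]]] := IH b.
have Hc : H (comm a' b') by rewrite /comm; do ?[apply: subM => //]; apply: subV.
apply: (cong_in sP (x := comm a' b')); last exact: prodP_l.
apply: (cong_mono (N := N)); first exact: prodP_r.
apply: comm_pert => //; [exact: gam_commr|exact: gam_comm|apply: gam_commr; exact: subM].
Qed.

Lemma Kstar_gam y : Kstar y <-> exists n, (0 < n)%nat /\ gam 1 (gpow y n).
Proof.
have e : gen (fun z : G => exists a b, z = comm a b) = gam 1.
  rewrite gamS; congr gen; apply: pred_ext => z.
  by split=> [[a [b ->]]|[a [b [_ ->]]]]; exists a, b.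
by rewrite /Kstar e.
Qed.

Lemma comm_gam1 a b : cong (gam 1) (a * b) (b * a).
Proof. by have := gam_comm b (gam0 a); have := gam_comm a (gam0 b); rewrite /cong /comm; gsimp. Qed.

Lemma gpow_gam1 a b n : gam 1 (gpow a n) -> gam 1 (gpow b n) -> gam 1 (gpow (a * b) n).
Proof.
move=> ha hb; apply: (cong_in (gam_sub G 1) (x := gpow a n * gpow b n)); last exact: subM.
apply: cong_sym => //; apply: (cong_gpowM _ (whole_sub G)) => //; exact: comm_gam1.
Qed.

Lemma gpowV x n : gpow x^-1 n = (gpow x n)^-1.
Proof. by elim: n => [|n IH]; rewrite ?gpow0 ?ginv1 // gpowS gpowSr IH ginvM. Qed.

Lemma Kstar_sub : subgroup (@Kstar G).
Proof.
split; [|split].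
- by apply/Kstar_gam; exists 1%nat; rewrite gpow1; split; [lia|exact: sub1].
- move=> x y /Kstar_gam [m [m0 hm]] /Kstar_gam [n [n0 hn]].
  apply/Kstar_gam; exists (m * n)%nat; split; first by nia.
  apply: gpow_gam1; first by rewrite gpowM; apply: sub_gpow.
  by rewrite Nat.mul_comm gpowM; apply: sub_gpow.
- move=> x /Kstar_gam [m [m0 hm]]; apply/Kstar_gam; exists m.
  by rewrite gpowV; split=> //; apply: subV.
Qed.

Lemma Kstar_normal : normalized full (@Kstar G).
Proof.
move=> s x _ /Kstar_gam [m [m0 hm]]; apply/Kstar_gam; exists m; split=> //.
by rewrite gpow_conj; apply: gam_conj.
Qed.

Lemma gam1_Kstar : subset (gam 1) (@Kstar G).
Proof. by move=> x hx; apply/Kstar_gam; exists 1%nat; rewrite gpowS gpow0 gmul1r; split; [lia|]. Qed.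

(** As a subgroup of a polycyclic group [Kstar] is finitely generated, so one exponent [m] sends all
    of it into [gam 1]; hence [gam 1] contains its m-th powers, which have finite index in it. *)
Lemma Kstar_fincov : polycyclic full -> fincov (@Kstar G) (cong (gam 1)).
Proof.
move=> pG; have pK : polycyclic (@Kstar G) by apply: (polycyclic_subgroup pG) => //; exact: Kstar_sub.
have [l el] := polycyclic_fg pK.
suff [m [m0 hm]] : exists m, (0 < m)%nat /\ forall x, Kstar x -> gam 1 (gpow x m).
  apply: fincov_mono (FIN_cov (polycyclic_powers pK m0)) => x y.
  by apply: cong_mono; apply: powers_min.
have [m [m0 hm]] : exists m, (0 < m)%nat /\ forall x, In x l -> gam 1 (gpow x m).
{ have : forall x, In x l -> Kstar x by move=> x hx; rewrite el; apply: gen_in.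
  elim: l {el} => [|r l IH] h1; first by exists 1%nat; split; [lia|].
  have [|m [m0 hm]] := IH; first by move=> s hs; apply: h1; right.
  have [|n [n0 hn]] := proj1 (Kstar_gam r); first by apply: h1; left.
  exists (n * m)%nat; split; first by nia.
  move=> s [<-|hs]; first by rewrite gpowM; apply: sub_gpow.
  by rewrite Nat.mul_comm gpowM; apply: sub_gpow => //; apply: hm. }
exists m; split=> // x; rewrite el; move: x.
apply: (gen_min (H := fun x => gam 1 (gpow x m))) => //.
split; [|split].
- by rewrite gpow1; exact: sub1.
- by move=> x y; apply: gpow_gam1.
- by move=> x; rewrite gpowV; apply: subV.
Qed.

End Nilpotent.

(** * The congruence subgroup property *)

Section Congruence.
Variable G : group.
Hypothesis pG : polycyclic (@whole G).
Implicit Types (x y : G) (N D K : G -> Prop) (s t : aut_group G) (Gs H : aut_group G -> Prop).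
Local Notation full := (@whole G).

Definition trivial_mod N s := forall w, cong N w (af s w).

Lemma af_morph s : morph (af s).
Proof. exact: af_hom. Qed.

Lemma id_morph : morph (fun x : G => x).
Proof. by []. Qed.

Lemma afM s t x : af (s * t) x = af s (af t x). Proof. by []. Qed.
Lemma afV s x : af s (af s^-1 x) = x. Proof. exact: agK. Qed.
Lemma afVr s x : af s^-1 (af s x) = x. Proof. exact: afK. Qed.

Lemma trivial_mod_sub N : subgroup N -> subgroup (trivial_mod N).
Proof.
move=> sN; split; [|split].
- by move=> w; apply: cong_refl.
- by move=> s t hs ht w; rewrite afM; apply: (cong_trans sN (ht w)); apply: hs.
- by move=> s hs w; apply: cong_sym => //; have := hs (af s^-1 w); rewrite afV.
Qed.

Lemma af_cong N s x y : (forall z, N z -> N (af s z)) -> cong N x y -> cong N (af s x) (af s y).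
Proof. by move=> h /h; rewrite af_morph (morphV _ (af_morph s)). Qed.

Lemma fix_sub Gs N y : subgroup Gs -> subgroup N -> (forall s z, Gs s -> N z -> N (af s z)) ->
  subgroup (fun s => Gs s /\ cong N y (af s y)).
Proof.
move=> sG sN st; split; [|split].
- by split; [exact: sub1|apply: cong_refl].
- move=> s t [Gss hs] [Gt ht]; split; first exact: subM.
  by apply: (cong_trans sN hs); apply: af_cong => // z; apply: st.
- move=> s [Gss hs]; have Gv := subV sG Gss; split=> //.
  apply: cong_sym => //; rewrite -{2}(afVr s y); apply: af_cong => // z; exact: st.
Qed.

Lemma fincov_inter Gs H A : subgroup H -> subgroup A -> subset A Gs -> fincov Gs (cong H) ->
  fincov A (cong (interP H A)).
Proof.
move=> sH sA AG h; have [l [h1 h2]] := fincov_sub (cong_per sH) AG h.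
exists l; split=> // x Ax; have [r [hr er]] := h2 x Ax; exists r; split=> //; split=> //.
by apply: subM => //; apply: subV => //; apply: h1.
Qed.

(** The concrete form of [C(G, Gam) = {e}]: every finite-index subgroup contains a congruence
    subgroup. *)
Definition CSP Gs := forall H, subgroup H -> fincov Gs (cong H) ->
  exists N, FING N /\ forall s, Gs s -> trivial_mod N s -> H s.

Section Step.
Variables (n : nat) (y : G).
Hypothesis n1 : (1 <= n)%nat.
Let N1 := gam (G := G) (Datatypes.S n).
Let phi s := y^-1 * af s y.

Let sN1 : subgroup N1. Proof. exact: gam_sub. Qed.
Let nN1 : normalized full N1. Proof. exact: gam_normalized. Qed.

(** In general [phi] is a crossed homomorphism, with [phi (s * t) = phi s * af s (phi t)]. As
    [n >= 1], [s] is trivial modulo [gam 1], hence by [gam_cong] acts trivially on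
    [gam n / gam n.+1], and the twist disappears. *)
Lemma disp_mul s t : trivial_mod (gam n) s -> trivial_mod (gam n) t ->
  cong N1 (phi (s * t)) (phi s * phi t).
Proof.
move=> hs ht; apply: cong_sym => //.
have -> : phi (s * t) = phi s * af s (phi t).
  by rewrite /phi afM af_morph (morphV _ (af_morph s)); gsimp.
apply: cong_mull; apply: gam_cong id_morph (af_morph s) _ (ht y) => w.
by apply: (cong_mono (gam_le n1)); apply: hs.
Qed.

(** The preimage in [G] of the image of [A] modulo [gam n.+1]; being saturated, it lets separability
    be applied in [G] itself, without quotient groups. *)
Definition disp_set (A : aut_group G -> Prop) : G -> Prop := fun d => exists s, A s /\ cong N1 (phi s) d.

Lemma disp_sub A : subgroup A -> (forall s, A s -> trivial_mod (gam n) s) -> subgroup (disp_set A).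
Proof.
move=> sA hA; split; [|split].
- by exists gone; split; [exact: sub1|rewrite /phi gmulVl; apply: cong_refl].
- move=> d e [s [As ds]] [t [At et]]; exists (s * t); split; first exact: subM.
  apply: (cong_trans sN1 (disp_mul (hA _ As) (hA _ At))).
  by apply: (cong_mul (whole_sub G)).
- move=> d [s [As ds]]; exists s^-1; split; first exact: subV.
  apply: cong_sym => //; apply: (cong_trans sN1 (y := (phi s)^-1)).
    by apply: (cong_inv (whole_sub G)) => //; apply: cong_sym.
  have := disp_mul (hA _ As) (hA _ (subV sA As)).
  rewrite {1}/phi gmulVr /= gmulVl /cong ginv1 gmul1l ginvK; exact.
Qed.

(* First replace [Gs] by its congruence subgroup [G'], inside which [H] contains the kernel of [phi]. *)
Lemma CSP_step Gs : subgroup Gs -> (forall s, Gs s -> trivial_mod (gam n) s) ->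
  CSP (fun s => Gs s /\ cong N1 y (af s y)) -> CSP Gs.
Proof.
move=> sG hG hker H sH fH.
have stab s z : Gs s -> N1 z -> N1 (af s z) by move=> _; exact: morph_gam (af_morph s).
have sk := fix_sub y sG sN1 stab.
have [|N [fN hN]] := hker _ (inter_sub sH sk).
  by apply: (fincov_inter sH sk _ fH) => s [].
set G' := interP Gs (trivial_mod N).
have sG' : subgroup G' by apply: inter_sub => //; apply: trivial_mod_sub; exact: FIN_sub fN.
have fH' : fincov G' (cong (interP H G')) by apply: (fincov_inter sH sG' _ fH) => s [].
have sH' : subgroup (interP H G') by exact: inter_sub.
have tG' s : G' s -> trivial_mod (gam n) s by case=> /hG.
have sK : subgroup (disp_set (interP H G')) by apply: disp_sub => // s [_ /tG'].
have [l [h1 h2]] := fH'.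
have fD : fincov (disp_set G') (cong (disp_set (interP H G'))).
  apply: (@pick_reps _ _ l _ _ (fun r => cong (disp_set (interP H G')) (phi r))).
    by move=> r d e hd he; apply: cong_trans he => //; apply: cong_sym.
  move=> d [s [G's ds]]; have [r [hr er]] := h2 s G's; exists r; split=> //.
  exists (r^-1 * s); split=> //.
  have := disp_mul (tG' _ (h1 r hr)) (tG' _ (proj2 er)); rewrite gmulK => e.
  have := cong_trans sN1 (cong_sym sN1 e) ds.
  by rewrite /cong; gsimp.
have [N' [fN' hN']] := finite_index_separable pG sK fD.
exists (interP N N'); split; first exact: FIN_inter.
move=> s Gss hs; have tN : trivial_mod N s by move=> w; case: (hs w).
have G's : G' s by [].
(* By the choice of [N'], [s] displaces [y] like some [h] in [H]; then [h^-1 * s] fixes [y] modulo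
   [N1] and is covered by [hN]. *)
have [h [[Hh G'h] eh]] : disp_set (interP H G') (phi s).
  apply: hN'; split; first by case: (hs y).
  by exists s; split=> //; apply: cong_refl.
rewrite -(gmulK h s); apply: subM => //.
apply: (proj1 (hN (h^-1 * s) _ _)); last first.
  by have [_] : G' (h^-1 * s) by apply: subM => //; apply: subV.
split; first by apply: subM => //; apply: subV => //; case: G'h.
rewrite -{1}(afVr h y) afM; apply: af_cong; first by move=> z; exact: morph_gam (af_morph _).
by move: eh; rewrite /cong /phi; gsimp.
Qed.
End Step.

Lemma CSP_gens n ys : (1 <= n)%nat ->
  (forall Gs, subgroup Gs -> (forall s, Gs s -> trivial_mod (gam n) s) ->
    (forall s y, Gs s -> In y ys -> cong (gam (Datatypes.S n)) y (af s y)) -> CSP Gs) ->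
  forall Gs, subgroup Gs -> (forall s, Gs s -> trivial_mod (gam n) s) -> CSP Gs.
Proof.
move=> n1; elim: ys => [|y ys IH] h; first by move=> Gs sG hG; apply: h.
apply: IH => Gs sG hG hys; apply: (CSP_step (y := y) n1) => //.
apply: h.
- by apply: fix_sub => // s z _; exact: morph_gam (af_morph s).
- by move=> s [/hG].
- by move=> s z [Gss hy] [<-//|hz]; apply: hys.
Qed.

(** Downward induction on [n], with [k] bounding [c - n]: once [n] reaches the class [c] the group
    is trivial, and fixing all generators modulo [gam n.+1] means being trivial modulo
    [gam n.+1]. *)
Lemma CSP_gam : fin_gen G -> nilpotent G -> forall n Gs, (1 <= n)%nat -> subgroup Gs ->
  (forall s, Gs s -> trivial_mod (gam n) s) -> CSP Gs.
Proof.
move=> [l hl] [c hc] n Gs n1 sG hG.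
suff Hk k : forall m Gs, (1 <= m)%nat -> (c <= m + k)%nat -> subgroup Gs ->
   (forall s, Gs s -> trivial_mod (gam m) s) -> CSP Gs.
  by apply: (Hk c n Gs n1 _ sG hG); lia.
elim: k {n n1 Gs sG hG} => [|k IH] n Gs n1 hn sG hG.
  move=> H sH _; exists full; split; first exact: FIN_refl.
  move=> s Gss _; have -> : s = gone; last exact: sub1.
  apply: aut_ext => x /=; have := gam_le (m := c) (n := n) _ (hG s Gss x).
  case; first by lia.
  by move=> /hc e; apply: (@gmulI _ x^-1); rewrite e gmulVl.
apply: (@CSP_gens n l) => // {}Gs {}sG {}hG hys.
apply: (IH (Datatypes.S n)) => //; [by lia|by lia|].
move=> s Gss w.
have se := equalizer_sub id_morph (af_morph s) (gam_sub G (Datatypes.S n)) (gam_normal (n := Datatypes.S n)).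
by apply: (hl w _ se) => z hz; apply: hys.
Qed.

Lemma CSP_IA Gs : fin_gen G -> nilpotent G -> subgroup Gs -> (forall s, Gs s -> IA s) -> CSP Gs.
Proof.
move=> fg nl sG hG H sH fH.
set G1 := interP Gs (trivial_mod (gam 1)).
have sG1 : subgroup G1 by apply: inter_sub => //; apply: trivial_mod_sub.
have [||N [fN hN]] := @CSP_gam fg nl 1 G1 (le_n 1) sG1 _ (interP H G1) (inter_sub sH sG1).
  by move=> s [].
  by apply: (fincov_inter sH sG1 _ fH) => s [].
(* Elements of [Gs] displace points inside [Kstar], and [N'] meets [Kstar] inside [gam 1]; so
   triviality modulo [N'] already puts [s] in [G1]. *)
have [N' [fN' hN']] := finite_index_separable pG (gam_sub G 1) (Kstar_fincov pG).
exists (interP N N'); split; first exact: FIN_inter.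
move=> s Gss hs; apply: (proj1 (hN s _ _)); last by move=> w; case: (hs w).
split=> // w; apply: hN'; split; first by case: (hs w).
exact: hG.
Qed.

End Congruence.

(** * Lifting automorphisms *)

Definition fun_group (X : Type) (G : group) : group.
Proof.
refine (@Group (X -> G) (fun f g x => f x * g x) (fun f x => (f x)^-1) (fun _ => gone) _ _ _).
- by move=> f g h; apply: functional_extensionality => x; rewrite gmulA.
- by move=> f; apply: functional_extensionality => x; rewrite gmul1l.
- by move=> f; apply: functional_extensionality => x; rewrite gmulVl.
Defined.

Lemma sig_ext (X : Type) (P : X -> Prop) (a b : {x | P x}) : proj1_sig a = proj1_sig b -> a = b.
Proof. by case: a b => [a ha] [b hb] /= e; subst b; congr exist; apply: proof_irrelevance. Qed.

Definition sub_group (G : group) (S : G -> Prop) (sS : subgroup S) : group.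
Proof.
refine (@Group {x | S x}
  (fun x y => exist _ (proj1_sig x * proj1_sig y) (subM sS (proj2_sig x) (proj2_sig y)))
  (fun x => exist _ (proj1_sig x)^-1 (subV sS (proj2_sig x)))
  (exist _ gone (sub1 sS)) _ _ _).
- by move=> x y z; apply: sig_ext; apply: gmulA.
- by move=> x; apply: sig_ext; apply: gmul1l.
- by move=> x; apply: sig_ext; apply: gmulVl.
Defined.

Section Words.
Variables (G : group) (l : list G).

Definition proj (x : G) : fun_group (G -> G) G := fun v => v x.
Definition word_map : fun_group (G -> G) G -> Prop := gen (fun w => exists x, In x l /\ w = proj x).
Lemma word_map_sub : subgroup word_map. Proof. exact: gen_sub. Qed.

(* The free group on [l] in the variety generated by [G], realised as word maps [G^G -> G]. *)
Definition words : group := sub_group word_map_sub.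

Definition ev (v : G -> G) (w : words) : G := proj1_sig w v.

Lemma ev_morph v : morph (ev v). Proof. by []. Qed.

Definition letter (x : G) : words :=
  match excluded_middle_informative (In x l) with
  | left h => exist _ (proj x) (gen_in (ex_intro _ x (conj h eq_refl)))
  | right _ => gone
  end.

Lemma ev_letter v x : In x l -> ev v (letter x) = v x.
Proof. by rewrite /letter; case: excluded_middle_informative. Qed.

Lemma words_ind (H : words -> Prop) : subgroup H -> (forall x, In x l -> H (letter x)) -> forall w, H w.
Proof.
move=> sH hl [w hw].
have [h e] : exists h : word_map w, H (exist _ w h); last by rewrite (proof_irrelevance _ hw h).
apply: (hw (fun w => exists h : word_map w, H (exist _ w h))).
{ split; [|split].
  - by exists (sub1 word_map_sub); exact: (sub1 sH).
  - move=> x y [hx Hx] [hy Hy]; exists (subM word_map_sub hx hy).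
    by have := subM sH Hx Hy.
  - by move=> x [hx Hx]; exists (subV word_map_sub hx); have := subV sH Hx. }
move=> _ [x [hx ->]]; have := hl x hx; rewrite /letter.
by case: excluded_middle_informative => // h; exists (gen_in (ex_intro _ x (conj h eq_refl))).
Qed.

Lemma subst_in (u : G -> words) (w : words) :
  word_map (fun v => ev (fun x => ev v (u x)) w).
Proof.
move: w; apply: words_ind; first split; [|split|].
- exact: (sub1 word_map_sub).
- by move=> x y hx hy; have := subM word_map_sub hx hy.
- by move=> x hx; have := subV word_map_sub hx.
- move=> x hx; have -> : (fun v => ev (fun x => ev v (u x)) (letter x)) = proj1_sig (u x).
  by apply: functional_extensionality => v; rewrite ev_letter.
exact: proj2_sig.
Qed.

(** The universal property of a relatively free group: any assignment of words to the letters
    extends to an endomorphism. *)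
Definition subst (u : G -> words) (w : words) : words := exist _ _ (subst_in u w).

Lemma ev_subst v u w : ev v (subst u w) = ev (fun x => ev v (u x)) w.
Proof. by []. Qed.

Lemma words_ext w w' : (forall v, ev v w = ev v w') -> w = w'.
Proof. by move=> h; apply: sig_ext; apply: functional_extensionality. Qed.

Lemma subst_morph u : morph (subst u).
Proof. by move=> x y; apply: words_ext. Qed.

Lemma subst_letter u x : In x l -> subst u (letter x) = u x.
Proof. by move=> hx; apply: words_ext => v; rewrite ev_subst ev_letter. Qed.

Lemma words_fg : fin_gen words.
Proof.
exists (map letter l); apply: words_ind; first exact: gen_sub.
by move=> x hx; apply: gen_in; apply: in_map.
Qed.

Lemma words_nilpotent : nilpotent G -> nilpotent words.
Proof.
move=> [c hc]; exists c => w hw; apply: words_ext => v; apply: hc.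
by have [] : gam c (ev v w) by apply: morph_gam.
Qed.

Lemma ev_cong N v v' : subgroup N -> normalized (@whole G) N ->
  (forall x, In x l -> cong N (v x) (v' x)) -> forall w, cong N (ev v w) (ev v' w).
Proof.
move=> sN nN h; apply: words_ind; first exact: equalizer_sub.
by move=> x hx; rewrite !ev_letter //; apply: h.
Qed.

Lemma ev_eq v v' w : (forall x, In x l -> v x = v' x) -> ev v w = ev v' w.
Proof.
move=> h; apply: (@gmulI _ (ev v w)^-1); rewrite gmulVl; symmetry.
apply: (@ev_cong (fun x => x = gone)); first exact: triv_sub.
  by move=> s _ _ ->; grp.
by move=> x /h ->; rewrite /cong gmulVl.
Qed.

End Words.

Section MorphPowers.
Variables A B : group.

Lemma morph_powers m (f : A -> B) x : morph f -> powers m (@whole A) x -> powers m (@whole B) (f x).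
Proof.
move=> h; apply: (powers_min (H := fun x => powers m (@whole B) (f x))); first by apply: preim_sub => //; exact: powers_sub.
by move=> y _; rewrite morph_gpow //; apply: powers_pow.
Qed.

Lemma surj_powers m (f : A -> B) y : morph f -> (forall y, exists x, f x = y) ->
  powers m (@whole B) y -> exists x, powers m (@whole A) x /\ f x = y.
Proof.
move=> h sf; apply: (powers_min (H := fun y => exists x, powers m (@whole A) x /\ f x = y)).
  by apply: im_sub => //; exact: powers_sub.
by move=> y' _; have [x <-] := sf y'; exists (gpow x m); rewrite morph_gpow //; split=> //; apply: powers_pow.
Qed.
End MorphPowers.

(** * Correcting approximate tuples layer by layer *)

Section Density.
Variables (G : group) (l : list G).
Hypothesis hl : forall x, gen (fun y => In y l) x.
Hypothesis nil : nilpotent G.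
Local Notation full := (@whole G).
Local Notation F := (words l).
Local Notation ev := (@ev G l).
Let e0 := ev (fun x => x).

Let fg : fin_gen G. Proof. by exists l. Qed.
Let pG : polycyclic full. Proof. exact: nilpotent_polycyclic. Qed.

Lemma ev_id_surj g : exists w, e0 w = g.
Proof.
apply: (hl g (H := fun g => exists w, e0 w = g)).
  have h : subgroup (fun g => exists w, (@whole F) w /\ e0 w = g) by exact: im_sub.
  have -> // : (fun g => exists w, e0 w = g) = (fun g => exists w, (@whole F) w /\ e0 w = g).
  by apply: pred_ext => x; split=> [[w ?]|[w [_ ?]]]; exists w.
by move=> x hx; exists (letter l x); rewrite /e0 ev_letter.
Qed.

(* [Ph N g h] : the class of [h] is the image of the class of [g] in [G/N] under a fixed automorphism of
   the profinite completion. *)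
Variable Ph : (G -> Prop) -> G -> G -> Prop.
Hypothesis Ph_ex : forall N g, FING N -> exists h, Ph N g h.
Hypothesis Ph_cong : forall N g h h', FING N -> Ph N g h -> (Ph N g h' <-> cong N h h').
Hypothesis Ph_mul : forall N g h g' h', FING N -> Ph N g h -> Ph N g' h' -> Ph N (g * g') (h * h').
Hypothesis Ph_mono : forall N M g h, FING N -> FING M -> subset N M -> Ph N g h -> Ph M g h.
Hypothesis Ph_surj : forall N h, FING N -> exists g, Ph N g h.
Hypothesis Ph_IA : forall N g h, FING N -> subset (@Kstar G) N -> Ph N g h -> cong N g h.

Lemma Ph_1 N : FING N -> Ph N gone gone.
Proof.
move=> fN; have sN := FIN_sub fN; have [h hh] := Ph_ex gone fN.
have hhh := Ph_mul fN hh hh; rewrite gmul1l in hhh.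
apply: (proj2 (Ph_cong _ fN hh)); apply: cong_sym => //; rewrite cong_1.
by have := proj1 (Ph_cong _ fN hh) hhh; rewrite /cong gmulVK.
Qed.

Lemma Ph_V N g h : FING N -> Ph N g h -> Ph N g^-1 h^-1.
Proof.
move=> fN hg; have sN := FIN_sub fN; have [k hk] := Ph_ex g^-1 fN.
have := Ph_mul fN hg hk; rewrite gmulVr => /(Ph_cong _ fN (Ph_1 fN)); rewrite cong_1 => hN.
by apply: (proj2 (Ph_cong _ fN hk)); apply: cong_sym => //; rewrite /cong ginvK.
Qed.

Definition approx N y := forall x, In x l -> Ph N x (y x).

Lemma approx_words N y w : FING N -> approx N y -> Ph N (e0 w) (ev y w).
Proof.
move=> fN h; move: w; apply: words_ind; last by move=> x hx; rewrite /e0 !ev_letter //; apply: h.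
split; [|split].
- exact: Ph_1.
- by move=> w w' h1 h2; apply: Ph_mul.
- by move=> w h1; apply: Ph_V.
Qed.

(** Enlarge [N] to the product of [Kstar] and [N], where the automorphism is the identity: the class
    prescribed for [x] modulo [N] therefore meets the coset of [x] modulo [Kstar]. *)
Lemma Kstar_rep N x : FING N -> exists t, Kstar t /\ Ph N x (x * t).
Proof.
move=> fN; have sN := FIN_sub fN; have [h hh] := Ph_ex x fN; set KN := prodP (@Kstar G) N.
have fK : FING KN.
{ apply: (FIN_mono _ _ _ _ fN) => //.
  - apply: prodP_sub => //; first exact: Kstar_sub.
    by apply: normalized_mono (FIN_norm fN).
  - by apply: prodP_normalized; [exact: Kstar_normal|exact: FIN_norm].
  - by apply: prodP_r; exact: Kstar_sub. }
have := Ph_mono fN fK (prodP_r (Kstar_sub G)) hh => /(Ph_IA fK) [|t [n [Kt [Nn e]]]].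
  exact: prodP_l.
exists t; split=> //; apply: (proj2 (Ph_cong _ fN hh)); apply: cong_sym => //.
by rewrite /cong ginvM gmulAr e gmulVK.
Qed.

(** Let [N0] meet [Kstar] inside [gam 1]. Two representatives that differ from [x] by elements of
    [Kstar] and agree modulo [N0] agree modulo [gam 1], so the choice made at [N0] is compatible
    with that at every other [N]. *)
Lemma abelian_action : exists a : G -> G, (forall x, cong (@Kstar G) x (a x)) /\
  forall N, FING N -> exists y, approx N y /\ forall x, cong (gam 1) (a x) (y x).
Proof.
have [N0 [fN0 hN0]] := finite_index_separable pG (gam_sub G 1) (Kstar_fincov pG).
have [t ht] := fchoice (fun x => Kstar_rep x fN0).
exists (fun x => x * t x); split; first by move=> x; rewrite /cong gmulVK; case: (ht x).
move=> N fN; have fI := FIN_inter fN fN0.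
have [t' ht'] := fchoice (fun x => Kstar_rep x fI).
exists (fun x => x * t' x); split.
  by move=> x _; have [_] := ht' x; apply: Ph_mono => // z [].
move=> x; have [Kt Pt] := ht x; have [Kt' Pt'] := ht' x.
have Pt0 : Ph N0 x (x * t' x) by apply: Ph_mono Pt' => // z [].
apply: hN0; split; first exact: (proj1 (Ph_cong _ fN0 Pt) Pt0).
rewrite ginvM gmulAr gmulVK; apply: subM => //; [exact: Kstar_sub|].
by apply: subV => //; exact: Kstar_sub.
Qed.

Variable a : G -> G.
Hypothesis base : forall N, FING N -> exists y, approx N y /\ forall x, cong (gam 1) (a x) (y x).

Definition lift_ok y := forall x, In x l -> cong (gam 1) (a x) (y x).

Lemma ok_cong n y y' (w : F) : lift_ok y -> lift_ok y' -> gam n w -> cong (gam (Datatypes.S n)) (ev y w) (ev y' w).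
Proof.
move=> h h'; apply: gam_cong => //; apply: ev_cong => // x hx.
by apply: cong_trans (h' x hx) => //; apply: cong_sym => //; apply: h.
Qed.

Lemma ok_cong1 y y' (w : F) : lift_ok y -> lift_ok y' -> cong (gam 1) (ev y w) (ev y' w).
Proof. by move=> h h'; apply: (@ok_cong 0). Qed.

(** By [nilpotent_gen] it is enough to reach everything modulo [gam 1]. There [y] agrees with tuples
    arbitrarily close to the given automorphism, which is surjective, so the image is dense; it is
    also closed. *)
Lemma ok_surj y : lift_ok y -> forall g, exists w, ev y w = g.
Proof.
move=> oky; set H := fun g => exists w : F, (@whole F) w /\ ev y w = g.
have sH : subgroup H by exact: im_sub.
suff h : forall g, H g by move=> g; have [w [_ <-]] := h g; exists w.
apply: nilpotent_gen => // g; apply: subgroup_closed => //; first exact: prodP_sub.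
move=> N fN; have [g0 hg0] := Ph_surj g fN; have [w ew] := ev_id_surj g0.
have [y' [ay' oky']] := base fN.
have hN : cong N (ev y' w) g.
  by apply: (proj1 (Ph_cong _ fN (approx_words w fN ay'))); rewrite ew.
exists (ev y' w), ((ev y' w)^-1 * g); split; last by split=> //; rewrite gmulK.
exists (ev y w), ((ev y w)^-1 * ev y' w); rewrite gmulK; split; first by exists w.
by split=> //; apply: ok_cong1 => // x _; apply: oky'.
Qed.

Let R (w : F) := e0 w = gone.

Lemma R_sub : subgroup R.
Proof. exact: (preim_sub (ev_morph _) (triv_sub G)). Qed.

Lemma R_approx N y w : FING N -> approx N y -> R w -> N (ev y w).
Proof.
move=> fN ha hR; have := approx_words w fN ha; rewrite hR => /(Ph_cong _ fN (Ph_1 fN)).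
by rewrite cong_1.
Qed.

(* The value [ev y w] mod [gam n.+1] depends only on [a] and is arbitrarily close to [1]. *)
Lemma R_gam n y w : lift_ok y -> R w -> gam n w -> gam (Datatypes.S n) (ev y w).
Proof.
move=> oky hR hw; apply: subgroup_closed => // N fN; have [y' [ay' oky']] := base fN.
exists (ev y w * (ev y' w)^-1), (ev y' w); split; last by split; [exact: (R_approx fN)|grp].
have : cong (gam (Datatypes.S n)) (ev y' w) (ev y w) by apply: ok_cong => // x _; apply: oky'.
by move=> /(gam_conj (ev y' w)); gsimp.
Qed.

(* [y] kills the relators modulo [gam i], and those in [Q] modulo [gam i.+1]. *)
Definition lift i (Q : F -> Prop) y :=
  [/\ lift_ok y, forall w, R w -> gam i (ev y w) & forall w, Q w -> gam (Datatypes.S i) (ev y w)].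

Definition dense i Q := forall N, FING N -> exists y, lift i Q y /\ approx N y.

(* [e0 w |-> ev y w] induces a surjective, hence injective, endomorphism of each finite quotient of
   [G / gam i] by the subgroup generated by [m]-th powers. *)
Lemma lift_inj i Q y w : lift i Q y -> gam i (ev y w) -> gam i (e0 w).
Proof.
move=> [oky hR _] hw; apply: subgroup_closed => // N fN.
have [m [m0 hm]] := fin_powers fN (whole_sub G).
have fP := polycyclic_powers pG m0; have sP := powers_sub m full.
set V := prodP (gam i) (powers m full).
have sV : subgroup V.
  by apply: prodP_sub => //; apply: normalized_mono (FIN_norm fP).
suff [x [z [hx [hz ->]]]] : V (e0 w) by exists x, z; split=> //; split=> //; apply: hm.
have VV v : V (e0 v) -> V (ev y v).
  move=> [z [p [hz [hp e]]]].
  have [zz [hzz ez]] := surj_gam (ev_morph _) ev_id_surj hz.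
  have [pp [hpp ep]] := surj_powers (ev_morph _) ev_id_surj hp.
  have hr : R (v * (zz * pp)^-1).
    move: e; rewrite /R /e0 ev_morph (morphV _ (ev_morph _)) ev_morph => ->.
    by rewrite ez ep gmulVr.
  have -> : v = v * (zz * pp)^-1 * (zz * pp) by grp.
  rewrite ev_morph; apply: subM => //; first by apply: prodP_l => //; apply: hR.
  by exists (ev y zz), (ev y pp); split; [apply: morph_gam|split=> //; apply: morph_powers].
(* A backward orbit [u] of [w]: the induced endomorphism sends [e0 (u k.+1)] to [e0 (u k)]. Two
   terms agree modulo [V]; applying the endomorphism moves the coincidence to [u 0], and once more
   puts an earlier term, hence [e0 w], in [V]. *)
have [nx hnx] := fchoice (fun v => ok_surj oky (e0 v)).
set u := fun k => Nat.iter k nx w.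
have uS k : ev y (u (Datatypes.S k)) = e0 (u k) by exact: hnx.
have [l' [_ hl']] := FIN_cov fP.
have [k|k [k' [kk hk]]] := @pigeon _ l' (cong V) (fun k => e0 (u k)) (cong_per sV).
  have [r [hr er]] := hl' (e0 (u k)) I; exists r; split=> //.
  by apply: cong_mono er; apply: prodP_r.
have c1 p d : V (e0 ((u p)^-1 * u (p + d)%nat)) -> V (e0 ((u 0%nat)^-1 * u d)).
  elim: p => // p IH /VV h; apply: IH.
  by move: h; rewrite /e0 !ev_morph !(morphV _ (ev_morph _)) !uS.
have h0 : V (e0 ((u 0%nat)^-1 * u (k' - k)%nat)).
  apply: (c1 k); have -> : (k + (k' - k))%nat = k' by lia.
  by move: hk; rewrite /e0 !ev_morph !(morphV _ (ev_morph _)).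
have c2 d : V (e0 (u d)) -> V (e0 w).
  by elim: d => // d IH /VV; rewrite uS.
have [d ed] : exists d, (k' - k)%nat = Datatypes.S d by exists (k' - k - 1)%nat; lia.
apply: (c2 d).
move: h0; rewrite ed => /VV; rewrite ev_morph (morphV _ (ev_morph _)) uS.
by apply: (subMl sV); apply: subV => //; apply: prodP_l.
Qed.

Lemma lift_decomp i Q y w : lift i Q y -> gam i (ev y w) -> exists r g, [/\ R r, gam i g & w = r * g].
Proof.
move=> hy /(lift_inj hy) hw; have [g [hg eg]] := surj_gam (ev_morph _) ev_id_surj hw.
exists (w * g^-1), g; split=> //; last by grp.
by rewrite /R /e0 ev_morph (morphV _ (ev_morph _)) eg gmulVr.
Qed.

(* Writing [y' = y1 \o rho] with [rho] an endomorphism of the words, take [y'' = y \o rho]. *)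
Lemma lift_heap i j Q y1 y y' : (Datatypes.S j <= i)%nat ->
  (forall r, R r -> gam (Datatypes.S j) r -> Q r) -> (forall r, Q r -> R r /\ gam j r) ->
  lift i Q y1 -> lift i Q y -> lift i Q y' ->
  exists y'', [/\ lift i Q y'',
    forall r, R r -> gam j r ->
      cong (gam (Datatypes.S i)) (ev y r * (ev y1 r)^-1 * ev y' r) (ev y'' r) &
    forall N, subgroup N -> normalized full N -> (forall x, In x l -> cong N (y1 x) (y x)) ->
      forall x, In x l -> cong N (y' x) (y'' x)].
Proof.
move=> ji lowQ highQ hy1 hy hy'.
have [ok1 R1 Q1] := hy1; have [ok2 R2 Q2] := hy; have [ok3 R3 Q3] := hy'.
(* [ev y1] is onto, hence maps [gam 1] of the words onto [gam 1] of the group; so the correction of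
   [y1 x] into [y' x] lifts to a commutator word. *)
have [u hu] : exists u : G -> F, forall x, In x l -> cong (gam 1) (letter l x) (u x) /\ ev y1 (u x) = y' x.
  apply: (@fchoice _ _ (fun x u => In x l -> cong (gam 1) (letter l x) u /\ ev y1 u = y' x)) => x.
  have [hx|nx] := classic (In x l); last by exists gone.
  have hz : cong (gam 1) (y1 x) (y' x).
    by apply: cong_trans (ok3 x hx) => //; apply: cong_sym => //; apply: ok1.
  have [z [zpow ez]] := surj_gam (ev_morph _) (ok_surj ok1) hz.
  exists (letter l x * z) => _; split; first by rewrite /cong gmulVK.
  by rewrite ev_morph ev_letter // ez gmulK.
set rho := subst u.
have e3 w : ev y1 (rho w) = ev y' w by rewrite ev_subst; apply: ev_eq => x /hu [].
have rho1 w : cong (gam 1) w (rho w).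
  move: w; apply: words_ind; first by apply: equalizer_sub => //; exact: subst_morph.
  by move=> x hx; rewrite /rho subst_letter //; case: (hu x hx).
set y'' := fun x => ev y (u x).
have e4 w : ev y'' w = ev y (rho w) by [].
have form r : R r -> gam j r -> cong (gam (Datatypes.S i)) (ev y r * (ev y1 r)^-1 * ev y' r) (ev y'' r).
  move=> hr gr; have hw : gam (Datatypes.S j) (r^-1 * rho r).
    by apply: (gam_cong _ _ rho1 gr) => //; exact: subst_morph.
  rewrite e4 -e3; have [w dw] : exists w, w = r^-1 * rho r by eexists.
  rewrite -dw in hw; have -> : rho r = r * w by rewrite dw gmulK.
  rewrite !ev_morph -gmulA gmulVK; apply: cong_mull.
  (* [w] splits into a relator of depth [j.+1], which belongs to [Q], and an element of [gam i]; on
     either factor [y] and [y1] agree modulo [gam i.+1], which gives the heap formula. *)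
  have gw : gam i (ev y1 w).
    rewrite dw ev_morph (morphV _ (ev_morph _)) e3; apply: subM => //; last exact: R3.
    by apply: subV => //; apply: R1.
  have [r' [g [hr' gg ew]]] := lift_decomp hy1 gw.
  have gr' : gam (Datatypes.S j) r'.
    have -> : r' = w * g^-1 by rewrite ew; grp.
    by apply: subM => //; apply: subV => //; apply: gam_le gg.
  have Qr' := lowQ r' hr' gr'; rewrite ew !ev_morph.
  apply: (cong_mul (whole_sub G)) => //; last exact: ok_cong.
  by apply: cong_mem => //; [apply: Q1|apply: Q2].
exists y''; split=> //; last first.
  move=> N sN nN h x hx; have [_ <-] := hu x hx.
  exact: ev_cong.
split.
- move=> x hx; apply: (cong_trans (gam_sub G 1) (ok2 x hx)).
  have [h1 _] := hu x hx; rewrite /y'' -(ev_letter y hx) /cong -(morphV _ (ev_morph y)) -ev_morph.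
  exact: morph_gam h1.
- move=> r hr; rewrite e4; have g1 : gam i (ev y1 (rho r)) by rewrite e3; apply: R3.
  have [r' [g [hr' gg ->]]] := lift_decomp hy1 g1; rewrite ev_morph.
  by apply: subM => //; [apply: R2|apply: morph_gam].
- move=> r hr; have [Rr gr] := highQ r hr.
  apply: (cong_in (gam_sub G _) (form r Rr gr)); apply: subM => //; last exact: Q3.
  by apply: subM => //; [apply: Q2|apply: subV => //; apply: Q1].
Qed.

(** Relative to a base lift [y1], the ratios of values of [r] on lifts still close to [y1] modulo
    [N] form a subgroup saturated modulo [gam i.+1]; the heap operation supplies its group law.
    Closeness to [y1] preserves the approximation at [N]. *)
Lemma dense_add i j Q r : (Datatypes.S j <= i)%nat ->
  (forall r, R r -> gam (Datatypes.S j) r -> Q r) -> (forall r, Q r -> R r /\ gam j r) ->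
  R r -> gam j r -> dense i Q -> dense i (fun w => w = r \/ Q w).
Proof.
move=> ji lowQ highQ Rr gr hd N fN; have sN := FIN_sub fN; have nN := FIN_norm fN.
have [y1 [hy1 ay1]] := hd N fN; set M := gam (G := G) (Datatypes.S i).
have sM : subgroup M by exact: gam_sub.
have nM : normalized full M by exact: gam_normalized.
set near := fun y => lift i Q y /\ forall x, In x l -> cong N (y1 x) (y x).
set D := fun d => exists y, near y /\ cong M ((ev y1 r)^-1 * ev y r) d.
have heap := lift_heap ji lowQ highQ.
have sD : subgroup D.
{ split; [|split].
  - exists y1; split; last by rewrite gmulVl; apply: cong_refl.
    by split=> // x _; apply: cong_refl.
  - move=> d d' [y [[hy ny] hd1]] [y' [[hy' ny'] hd']].
    have [y'' [h1 h2 h3]] := heap _ _ _ hy1 hy hy'.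
    exists y''; split.
      split=> // x hx; apply: (cong_trans sN (ny' x hx)); exact: h3.
    have := h2 r Rr gr => /(cong_mull (ev y1 r)^-1) /(cong_sym sM) h4.
    apply: (cong_trans sM h4); rewrite -gmulA !gmulA -gmulA.
    by apply: (cong_mul (whole_sub G)) => //; rewrite gmulA.
  - move=> d [y [[hy ny] hd1]].
    (* Inversion is the heap operation with the roles exchanged: base point [y], both outer entries
       [y1]. *)
    have [y'' [h1 h2 h3]] := heap _ _ _ hy hy1 hy1.
    exists y''; split.
      split=> // x hx; apply: h3 => // z hz; apply: cong_sym => //; exact: ny.
    have := h2 r Rr gr => /(cong_mull (ev y1 r)^-1) /(cong_sym sM) h4.
    apply: (cong_trans sM h4); have := cong_inv (whole_sub G) sM nM I hd1.
    by rewrite /cong; gsimp. }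
(* This membership says that some nearby lift kills [r] modulo [gam i.+1]. Lifts approximating at
   [N'] send [r] into [N'], which puts the required ratio in the closure of [D]. *)
have [y [[hy ny] hr]] : D (ev y1 r)^-1.
{ apply: subgroup_closed => // N' fN'; have fI := FIN_inter fN fN'.
  have [y2 [hy2 ay2]] := hd _ fI.
  exists ((ev y1 r)^-1 * ev y2 r), (ev y2 r)^-1; split; last first.
    split; last by grp.
    apply: subV; first exact: FIN_sub fN'.
    by have [] := R_approx fI ay2 Rr.
  exists y2; split; last by apply: cong_refl.
  split=> // x hx; apply: (proj1 (Ph_cong _ fN (ay1 x hx))).
  by apply: (Ph_mono fI fN _ (ay2 x hx)) => z []. }
have [oky hyR hyQ] := hy.
exists y; split.
  split=> // w [->|]; last exact: hyQ.
  by have := subV sM hr; rewrite /M; gsimp.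
by move=> x hx; apply/(Ph_cong _ fN (ay1 x hx)); apply: ny.
Qed.

(** Relators in [gam i] cost nothing by [R_gam]. From there the depth [i - k] decreases to [0]; at
    each depth the relators form a finitely generated subgroup, and [dense_add] is iterated over its
    generators. *)
Lemma dense_S i : dense i (fun _ => False) -> dense (Datatypes.S i) (fun _ => False).
Proof.
move=> hd.
have pF : polycyclic (@whole F).
  by apply: nilpotent_polycyclic; [exact: words_fg|exact: words_nilpotent].
have hk k : (k <= i)%nat -> dense i (fun w => R w /\ gam (i - k) w).
{ elim: k => [|k IH] hk.
    move=> N fN; have [y [[oky hR _] ay]] := hd N fN; exists y; split=> //; split=> //.
    by rewrite Nat.sub_0_r => w [hw gw]; apply: R_gam.
  have {}IH := IH (Nat.lt_le_incl _ _ hk).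
  set j := (i - Datatypes.S k)%nat; have ej : (i - k)%nat = Datatypes.S j by rewrite /j; lia.
  rewrite ej in IH; have ji : (Datatypes.S j <= i)%nat by rewrite /j; lia.
  have sRj : subgroup (fun w => R w /\ gam j w) by exact: (inter_sub R_sub (gam_sub _ j)).
  have pRj := polycyclic_subgroup pF sRj (fun _ _ => I).
  have [rs ers] := polycyclic_fg pRj.
  have hrs w : In w rs -> R w /\ gam j w.
    by move=> hw; have := gen_in (A := fun w => In w rs) hw; rewrite -ers.
  have hadd rs' : (forall w, In w rs' -> R w /\ gam j w) ->
      dense i (fun w => In w rs' \/ R w /\ gam (Datatypes.S j) w).
    elim: rs' => [|r rs' IH'] h.
      move=> N fN; have [y [[oky hR hQ] ay]] := IH N fN; exists y; split=> //; split=> //.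
      by move=> w [[]|]; apply: hQ.
    have [hr1 hr2] := h r (or_introl eq_refl).
    have {}IH' := IH' (fun w hw => h w (or_intror hw)).
    have h1 w : In w rs' \/ R w /\ gam (Datatypes.S j) w -> R w /\ gam j w.
      by case=> [hw|[hw /gam_dec gw]]; [apply: h; right|].
    have := dense_add ji (fun w hw gw => or_intror (conj hw gw)) h1 hr1 hr2 IH'.
    move=> h2 N fN; have [y [[oky hR hQ] ay]] := h2 N fN; exists y; split=> //; split=> //.
    by move=> w [[<-|hw]|hw]; apply: hQ; [left|right; left|right; right].
  move=> N fN; have [y [[oky hR hQ] ay]] := hadd rs hrs N fN; exists y; split=> //; split=> //.
  suff h : subset (gen (fun w => In w rs)) (fun w => gam (Datatypes.S i) (ev y w)).
    by rewrite -ers in h.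
  apply: gen_min; first exact: (preim_sub (ev_morph _) (gam_sub _ _)).
  by move=> w hw; apply: hQ; left. }
move=> N fN; have [y [[oky hR hQ] ay]] := hk i (le_n i) N fN; exists y; split=> //; split=> //.
by move=> w hw; apply: hQ; rewrite Nat.sub_diag.
Qed.

Lemma dense_all i : dense i (fun _ => False).
Proof.
elim: i => [|i IH]; last exact: dense_S.
by move=> N fN; have [y [ay hy]] := base fN; exists y; split=> //; split=> // x _; apply: hy.
Qed.

Hypothesis aK : forall x, cong (@Kstar G) x (a x).

Lemma dense_aut N : FING N -> exists s : aut G, IA s /\ forall g, Ph N g (af s g).
Proof.
move=> fN; have [c hc] := nil.
have [y [hy ay]] := dense_all c fN; have [oky hR _] := hy.
have hc' (x : G) : gam c x -> x = gone by case; apply: hc.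
have inj w w' : ev y w = ev y w' -> e0 w = e0 w'.
  move=> e; symmetry; apply: (@gmulI _ (e0 w)^-1); rewrite gmulVl.
  have : gam c (e0 (w^-1 * w')).
    apply: (lift_inj hy); rewrite ev_morph (morphV _ (ev_morph _)) e gmulVl; exact: sub1.
  by move=> /hc'; rewrite /e0 ev_morph (morphV _ (ev_morph _)).
have wd w w' : e0 w = e0 w' -> ev y w = ev y w'.
  move=> e; symmetry; apply: (@gmulI _ (ev y w)^-1); rewrite gmulVl.
  apply: hc'; rewrite -(morphV _ (ev_morph _)) -ev_morph; apply: hR.
  by rewrite /R /e0 ev_morph (morphV _ (ev_morph _)) -/e0 e gmulVl.
have [wd1 hwd1] := fchoice ev_id_surj; have [wd2 hwd2] := fchoice (ok_surj oky).
set s := fun g => ev y (wd1 g).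
have sE w : s (e0 w) = ev y w by apply: wd; rewrite hwd1.
have sM g h : s (g * h) = s g * s h.
  have -> : g * h = e0 (wd1 g * wd1 h) by rewrite /e0 ev_morph -/e0 !hwd1.
  by rewrite sE ev_morph.
have sK g : e0 (wd2 (s g)) = g by rewrite -{2}(hwd1 g); apply: inj; rewrite hwd2.
have Ks g : s (e0 (wd2 g)) = g by rewrite sE hwd2.
exists (@Aut G s (fun g => e0 (wd2 g)) sM sK Ks); split; last first.
  by move=> g /=; rewrite -{1}(hwd1 g); apply: approx_words.
move=> g /=; have sm : morph s by [].
have se := equalizer_sub (id_morph (G := G)) sm (Kstar_sub G) (Kstar_normal (G := G)).
apply: (hl g se) => x hx.
have -> : s x = y x by rewrite -{1}(ev_letter (fun x => x) hx) sE ev_letter.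
apply: (cong_trans (Kstar_sub G) (aK x)); apply: (cong_mono (gam1_Kstar (G := G))); exact: oky.
Qed.

End Density.

(** * Profinite completions *)

Section Completion.
Variables (X : group) (Sg : X -> Prop).
Hypothesis sSg : subgroup Sg.
Implicit Types (x y : Fam X) (N M : X -> Prop).

Lemma comp_ex x N : completion_elem Sg x -> FIN Sg N -> exists a, x N a.
Proof.
move=> [h _] fN; have [r [_ hr]] := h N fN; exists r; apply/hr.
by rewrite gmulVl; exact: sub1 (FIN_sub fN).
Qed.

Lemma comp_cong x N a b : completion_elem Sg x -> FIN Sg N -> x N a -> (x N b <-> cong N a b).
Proof.
move=> [h _] fN; have [r [_ hr]] := h N fN; have sN := FIN_sub fN.
move=> /hr ha; split=> [/hr hb|hab].
  by apply: cong_trans hb => //; apply: cong_sym.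
by apply/hr; apply: cong_trans hab.
Qed.

Lemma comp_in x N a : completion_elem Sg x -> FIN Sg N -> x N a -> Sg a.
Proof.
move=> [h _] fN; have [r [Sr hr]] := h N fN; move=> /hr ha.
by rewrite -(gmulK r a); apply: subM => //; exact: FIN_in fN _ ha.
Qed.

Lemma comp_mono x N M a : completion_elem Sg x -> FIN Sg N -> FIN Sg M -> subset N M -> x N a -> x M a.
Proof. by move=> [_ [_ h]] fN fM NM; apply: h. Qed.

Lemma comp_FIN x N a : completion_elem Sg x -> x N a -> FIN Sg N.
Proof. by move=> [_ [h _]] xa; apply: NNPP => nN; apply: (h N nN a). Qed.

Lemma comp_eq x y N a : completion_elem Sg x -> completion_elem Sg y -> FIN Sg N ->
  x N a -> y N a -> x N = y N.
Proof.
move=> hx hy fN xa ya; apply: pred_ext => z.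
by rewrite (comp_cong z hx fN xa) (comp_cong z hy fN ya).
Qed.

Lemma comp_ext x y : completion_elem Sg x -> completion_elem Sg y ->
  (forall N, FIN Sg N -> exists M a, [/\ FIN Sg M, subset M N, x M a & y M a]) -> x = y.
Proof.
move=> hx hy h; apply: functional_extensionality => N.
have [fN|nN] := classic (FIN Sg N).
  have [M [a [fM MN xa ya]]] := h N fN.
  by apply: (comp_eq (a := a)) => //; apply: (comp_mono (N := M)).
by apply: pred_ext => z; split=> /comp_FIN h'; case: nN; apply: h'.
Qed.

Lemma comp_intro x : (forall N, FIN Sg N -> exists r, Sg r /\ forall z, x N z <-> cong N r z) ->
  (forall N z, x N z -> FIN Sg N) ->
  (forall N M z, FIN Sg N -> FIN Sg M -> subset N M -> x N z -> x M z) -> completion_elem Sg x.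
Proof.
move=> h1 h2 h3; split=> //; split=> [N nN z /h2 //|N M fN fM NM z].
exact: h3.
Qed.

(** The inverse in the completion, which provides the preimages for surjectivity in [nu_haut]. *)
Definition comp_inv x : Fam X := fun N z => x N z^-1.

Lemma comp_inv_elem x : completion_elem Sg x -> completion_elem Sg (comp_inv x).
Proof.
move=> hx; apply: comp_intro => [N fN|N z|N M z fN fM NM].
- have [r xr] := comp_ex hx fN; have Sr := comp_in hx fN xr; have sN := FIN_sub fN.
  exists r^-1; split; first exact: subV.
  move=> z; rewrite /comp_inv (comp_cong _ hx fN xr) /cong ginvK.
  split=> h.
    by have := FIN_norm fN Sr (subV sN h); gsimp.
  by have := normalizedV sSg (FIN_norm fN) Sr (subV sN h); gsimp.
- exact: comp_FIN hx.
- exact: (comp_mono hx).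
Qed.

End Completion.

Section Hat.
Variable G : group.
Local Notation full := (@whole G).
Implicit Types (N M : G -> Prop) (x y : Fam G) (s t : aut_group G).

Definition iota (g : G) : Fam G := fun N z => FING N /\ cong N g z.

Lemma iota_hat g : hat (iota g).
Proof.
apply: comp_intro => [N fN|N z []//|N M z fN fM NM [_ h]].
  by exists g; split=> // z; split=> [[]|].
by split=> //; apply: cong_mono h.
Qed.

Lemma iota_in g N : FING N -> iota g N g.
Proof. by move=> fN; split=> //; apply: cong_refl; exact: FIN_sub fN. Qed.

Lemma hmul_hat x y : hat x -> hat y -> hat (hmul x y).
Proof.
move=> hx hy; apply: comp_intro => [N fN|N z [a [b [xa _]]]|N M z fN fM NM [a [b [xa [yb ->]]]]].
- have [a xa] := comp_ex hx fN; have [b yb] := comp_ex hy fN; exists (a * b); split=> // z.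
  have sN := FIN_sub fN; have nN := FIN_norm fN.
  split=> [[a' [b' [xa' [yb' ->]]]]|h].
    by apply: (cong_mul (whole_sub G)) => //; [apply/(comp_cong _ hx fN xa)|apply/(comp_cong _ hy fN yb)].
  exists a, (a^-1 * z); split=> //; split; last by rewrite gmulK.
  by apply/(comp_cong _ hy fN yb); move: h; rewrite /cong; gsimp.
- exact: (comp_FIN hx xa).
- by exists a, b; split; [exact: (comp_mono hx fN)|split; [exact: (comp_mono hy fN)|]].
Qed.

Lemma iota_mul g h : hmul (iota g) (iota h) = iota (g * h).
Proof.
apply: (comp_ext (Sg := full)); [exact: hmul_hat (iota_hat _) (iota_hat _)|exact: iota_hat|].
move=> N fN; exists N, (g * h); split=> //; last exact: iota_in.
by exists g, h; split; [exact: iota_in|split=> //; exact: iota_in].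
Qed.

Lemma preim_FIN s N : FING N -> FING (fun v => N (af s v)).
Proof.
move=> fN; have sN := FIN_sub fN; apply: FIN_I => //.
- exact: preim_sub (af_morph s) sN.
- move=> g n _ hn; rewrite !(af_morph s) (morphV _ (af_morph s)); exact: FIN_norm fN _ _ I hn.
- apply: (fincov_pull (f := af s) (cong_per sN) (FIN_cov fN)) => // x y.
  by rewrite /cong (af_morph s) (morphV _ (af_morph s)).
Qed.

Lemma preim_FIN_inv s N : FING (fun v => N (af s v)) -> FING N.
Proof.
move=> /(preim_FIN s^-1); have -> // : (fun v => N (af s (af s^-1 v))) = N.
by apply: pred_ext => v; rewrite afV.
Qed.

Lemma actE s x N z : act s x N z <-> x (fun v => N (af s v)) (af s^-1 z).
Proof.
split=> [[w [xw ->]]|h]; first by rewrite afVr.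
by exists (af s^-1 z); rewrite afV.
Qed.

Lemma act_cong s x N w z : hat x -> FING N -> x (fun v => N (af s v)) w -> (act s x N z <-> cong N (af s w) z).
Proof.
move=> hx fN xw; rewrite actE (comp_cong _ hx (preim_FIN s fN) xw).
by rewrite {1}/cong (af_morph s) (morphV _ (af_morph s)) afV.
Qed.

Lemma act_trivial s t x N : hat x -> FING N -> trivial_mod N t -> act (t * s) x N = act s x N.
Proof.
move=> hx fN ht; have sN := FIN_sub fN; apply: pred_ext => z; rewrite !actE.
have -> : (fun v => N (af (t * s) v)) = (fun v => N (af s v)).
  by apply: pred_ext => v; split=> h; [apply: (cong_in sN _ h); apply: cong_sym|apply: (cong_in sN _ h)].
have fP := preim_FIN s fN.
have e : cong (fun v => N (af s v)) (af s^-1 z) (af (t * s)^-1 z).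
  rewrite /cong (af_morph s) (morphV _ (af_morph s)) afV ginvM afM afV.
  exact: (subV (trivial_mod_sub sN) ht).
have sP := FIN_sub fP.
split=> h; first by apply/(comp_cong _ hx fP h); apply: cong_sym.
exact/(comp_cong _ hx fP h).
Qed.

Lemma powers_af m s z : powers m full (af s z) <-> powers m full z.
Proof.
split=> h; last by apply: morph_powers => //; exact: af_morph.
by rewrite -(afVr s z); apply: morph_powers => //; exact: af_morph.
Qed.

(** * The natural map from the completion of a group of automorphisms *)

Section Nu.
Variable Gs : aut_group G -> Prop.
Hypothesis sG : subgroup Gs.
Hypothesis fg : fin_gen G.
Hypothesis pG : polycyclic full.

Let Hm m := interP Gs (trivial_mod (powers m full)).

(** Modulo m-th powers an automorphism is determined by the images of finitely many generators in a
    finite group; invariance of the m-th powers under automorphisms makes the kernel normal. *)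
Lemma cong_FIN m : (0 < m)%nat -> FIN Gs (Hm m).
Proof.
move=> m0; have sP := powers_sub m full; have fP := polycyclic_powers pG m0; have nP := FIN_norm fP.
have sH : subgroup (Hm m) by apply: inter_sub => //; exact: trivial_mod_sub.
apply: FIN_I => //; first by move=> s [].
  move=> s t Gss [Gt ht]; split; first by apply: subM; [|apply: subM|apply: subV].
  move=> w; rewrite !afM -{1}(afV s w); apply: af_cong; last exact: ht.
  by move=> z hz; apply/powers_af.
have [l hl] := fg.
have [l' [h1 h2]] : fincov Gs (fun s t => forall x : G, In x l -> cong (powers m full) (af s x) (af t x)).
{ elim: l {hl} => [|y l IH].
    by exists (gone :: List.nil); split=> [r [<-|[]]|x hx]; [exact: sub1|exists gone; split; [left|]].
  have h : fincov Gs (fun s t => cong (powers m full) (af s y) (af t y)).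
    exact: (fincov_pull (f := fun s => af s y) (cong_per sP) (FIN_cov fP)).
  have [||l' [h1 h2]] := fincov_and _ _ h IH.
  - by split=> [s t|s t u]; [exact: cong_sym|exact: cong_trans].
  - split=> [s t hst x hx|s t u hst htu x hx]; first by apply: cong_sym => //; apply: hst.
    by apply: (cong_trans sP (hst x hx)); apply: htu.
  - exists l'; split=> // s /h2 [r [hr [e1 e2]]]; exists r; split=> // x [<-//|hx].
    exact: e2. }
exists l'; split=> // s Gss; have [r [hr e]] := h2 s Gss; exists r; split=> //.
split; first by apply: subM => //; apply: subV => //; apply: h1.
move=> w; rewrite afM -{1}(afVr r w); apply: af_cong; first by move=> z hz; apply/powers_af.
by apply: (hl w _ (equalizer_sub (af_morph r) (af_morph s) sP nP)) => x hx; apply: e.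
Qed.

(** Independence of the choices in [nu]: two pairs [H, s] and [H', s'] are compared through a
    representative of [g] at the intersection of [H] and [H']. *)
Lemma nu_act g H s x N : completion_elem Gs g -> hat x -> FING N -> FIN Gs H ->
  (forall t, H t -> trivial_mod N t) -> g H s -> nu Gs g x N = act s x N.
Proof.
move=> hg hx fN fH tH gs; apply: pred_ext => z; split=> [|h]; last by exists H, s.
move=> [H' [s' [fH' [tH' [gs' h]]]]].
have fI := FIN_inter fH fH'; have [r gr] := comp_ex hg fI.
have same K k : FIN Gs K -> (forall t, K t -> trivial_mod N t) -> subset (interP H H') K ->
    g K k -> act r x N = act k x N.
  move=> fK tK IK gk; have gKr := comp_mono hg fI fK IK gr.
  have := proj1 (comp_cong _ hg fK gk) gKr => /(FIN_norm fK (comp_in sG hg fK gk)) /tK.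
  move=> /(act_trivial k hx fN) <-; congr (act _ x N).
  by rewrite !gmulA gmulVr gmul1l -gmulA gmulVl gmul1r.
have <- : act r x N = act s x N by apply: (same H) => // t [].
have -> : act r x N = act s' x N by apply: (same H') => // t [].
done.
Qed.

(** One automorphism [s] represents [g] at all [N] above the m-th powers simultaneously, which
    reduces statements about [nu] to statements about [act s]. *)
Lemma nu_powers g m : completion_elem Gs g -> (0 < m)%nat -> exists s, [/\ Gs s, g (Hm m) s &
  forall x N, hat x -> FING N -> subset (powers m full) N -> nu Gs g x N = act s x N].
Proof.
move=> hg m0; have fH := cong_FIN m0; have [s gs] := comp_ex hg fH; exists s; split=> //.
  exact: (comp_in sG hg fH gs).
move=> x N hx fN hN; apply: (nu_act hg hx fN fH) => // t [_ ht] w.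
exact: cong_mono hN (ht w).
Qed.

Lemma nu_hat g x : completion_elem Gs g -> hat x -> hat (nu Gs g x).
Proof.
move=> hg hx; apply: comp_intro => [N fN|N z|N M z fN fM NM].
- have [m [m0 hm]] := fin_powers fN (whole_sub G); have [s [_ _ hs]] := nu_powers hg m0.
  have [w xw] := comp_ex hx (preim_FIN s fN); exists (af s w); split=> // z.
  by rewrite (hs x N) //; apply: act_cong.
- move=> [H [s [_ [_ [_ [w [xw _]]]]]]]; apply: (@preim_FIN_inv s); exact: (comp_FIN hx xw).
- have [m [m0 hm]] := fin_powers fN (whole_sub G); have [s [_ _ hs]] := nu_powers hg m0.
  have hmM : subset (powers m full) M by move=> v /hm /NM.
  rewrite (hs x N hx fN hm) (hs x M hx fM hmM) !actE.
  by apply: (comp_mono hx (preim_FIN s fN) (preim_FIN s fM)) => v; apply: NM.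
Qed.

Lemma act_powers s x m z : act s x (powers m full) z <-> x (powers m full) (af s^-1 z).
Proof.
rewrite actE; have -> // : (fun v => powers m full (af s v)) = powers m full.
by apply: pred_ext => v; apply: powers_af.
Qed.

Lemma hat_ext x y : hat x -> hat y -> (forall m, (0 < m)%nat -> forall z, x (powers m full) z -> y (powers m full) z) -> x = y.
Proof.
move=> hx hy h; apply: (comp_ext hx hy) => N fN.
have [m [m0 hm]] := fin_powers fN (whole_sub G); have fP := polycyclic_powers pG m0.
have [a xa] := comp_ex hx fP; exists (powers m full), a; split=> //; exact: h.
Qed.

Lemma nu_haut g : completion_elem Gs g -> is_haut (nu Gs g).
Proof.
move=> hg; split; [|split; [|split; [|split]]].
- by move=> x hx; apply: nu_hat.
- move=> x y hx hy; have hxy := hmul_hat hx hy; have nx := nu_hat hg hx; have ny := nu_hat hg hy.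
  apply: hat_ext => [||m m0 z]; [exact: nu_hat|exact: hmul_hat|].
  have [s [_ _ hs]] := nu_powers hg m0; have fP := polycyclic_powers pG m0.
  rewrite (hs _ _ hxy fP) //; move=> [w [[a [b [xa [yb ->]]]] ->]].
  exists (af s a), (af s b); split; first by rewrite (hs _ _ hx fP) //; exists a.
  by split; [rewrite (hs _ _ hy fP) //; exists b|exact: af_morph].
- move=> x y hx hy e; apply: hat_ext => // m m0 z xz.
  have [s [_ _ hs]] := nu_powers hg m0; have fP := polycyclic_powers pG m0.
  have : act s x (powers m full) (af s z) by rewrite act_powers afVr.
  by rewrite -(hs _ _ hx fP) // e (hs _ _ hy fP) // act_powers afVr.
- move=> y hy; have hg' := comp_inv_elem sG hg; exists (nu Gs (comp_inv g) y).
  have hx := nu_hat hg' hy; split=> //; symmetry; apply: hat_ext => [//||m m0 z yz]; first exact: nu_hat.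
  have [s [_ gs hs]] := nu_powers hg m0; have fP := polycyclic_powers pG m0.
  have e : nu Gs (comp_inv g) y (powers m full) = act s^-1 y (powers m full).
    apply: (nu_act hg' hy fP (cong_FIN m0)) => [t []//|].
    by rewrite /comp_inv ginvK.
  by rewrite (hs _ _ hx fP) // act_powers e act_powers ginvK afV.
- move=> N fN; have [m [m0 hm]] := fin_powers fN (whole_sub G); have fP := polycyclic_powers pG m0.
  exists (powers m full); split=> // x y hx hy e; have [s [_ _ hs]] := nu_powers hg m0.
  have [w xw] := comp_ex hx fP.
  have hz u : hat u -> u (powers m full) w -> nu Gs g u N (af s w).
    move=> hu uw; apply: (comp_mono (nu_hat hg hu) fP fN hm); rewrite (hs _ _ hu fP) //.
    by rewrite act_powers afVr.
  by apply: (comp_eq (nu_hat hg hx) (nu_hat hg hy) fN (hz x hx xw)); apply: hz => //; rewrite -e.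
Qed.

Lemma nu_IAhat g : (forall s, Gs s -> IA s) -> completion_elem Gs g -> IAhat (nu Gs g).
Proof.
move=> hIA hg; split; first exact: nu_haut.
move=> x hx N fN KN; have [m [m0 hm]] := fin_powers fN (whole_sub G).
have [s [Gss _ hs]] := nu_powers hg m0; rewrite (hs _ _ hx fN hm); have sN := FIN_sub fN.
have ts : trivial_mod N s by move=> w; apply: KN; exact: hIA.
have := act_trivial gone hx fN ts; rewrite gmul1r => ->.
by apply: pred_ext => z; rewrite actE.
Qed.

(** On the dense elements [iota w], equality of the images says that [s2^-1 * s1] is trivial modulo
    m-th powers, hence modulo the [N] that [CSP_IA] attaches to [H]; so it lies in [H]. *)
Lemma nu_inj g1 g2 : nilpotent G -> (forall s, Gs s -> IA s) ->
  completion_elem Gs g1 -> completion_elem Gs g2 ->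
  (forall x, hat x -> nu Gs g1 x = nu Gs g2 x) -> g1 = g2.
Proof.
move=> nl hIA h1 h2 e; apply: (comp_ext h1 h2) => H fH.
have [N [fN hN]] := CSP_IA pG fg nl sG hIA (FIN_sub fH) (FIN_cov fH).
have [m [m0 hm]] := fin_powers fN (whole_sub G); have fP := polycyclic_powers pG m0.
have fI := FIN_inter fH (cong_FIN m0).
have [s1 gs1] := comp_ex h1 fI; have [s2 gs2] := comp_ex h2 fI.
have Gs1 := comp_in sG h1 fI gs1; have Gs2 := comp_in sG h2 fI gs2.
have nuE g s w : completion_elem Gs g -> g (interP H (Hm m)) s ->
    nu Gs g (iota w) (powers m full) = act s (iota w) (powers m full).
  by move=> hg gs; apply: (nu_act hg (iota_hat w) fP fI) => // t [_ []].
have t12 : trivial_mod N (s2^-1 * s1).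
  move=> w; apply: (cong_mono hm).
  have : act s1 (iota w) (powers m full) (af s1 w) by rewrite act_powers afVr; exact: iota_in.
  by rewrite -(nuE g1 s1 w h1 gs1) (e _ (iota_hat w)) (nuE g2 s2 w h2 gs2) act_powers => -[].
exists H, s1; split=> //; first by apply: (comp_mono h1 fI fH _ gs1) => t [].
have g2H : g2 H s2 by apply: (comp_mono h2 fI fH _ gs2) => t [].
apply/(comp_cong _ h2 fH g2H); apply: hN => //; apply: subM => //; exact: subV.
Qed.

End Nu.

Lemma IAhat_dense (phi : Fam G -> Fam G) N : fin_gen G -> nilpotent G -> IAhat phi -> FING N ->
  exists s : aut G, IA s /\ forall x, hat x -> act s x N = phi x N.
Proof.
move=> fg nl [[hH [hM [hI [hS hC]]]] hIA] fN; have pG := nilpotent_polycyclic fg nl.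
have [l hl] := fg.
set Ph := fun N g h => phi (iota g) N h.
have hio g : hat (phi (iota g)) by apply: hH; exact: iota_hat.
have Ph_ex M g : FING M -> exists h, Ph M g h by move=> fM; exact: comp_ex (hio g) fM.
have Ph_cong M g h h' : FING M -> Ph M g h -> (Ph M g h' <-> cong M h h').
  by move=> fM hh; exact: comp_cong (hio g) fM hh.
have Ph_mul M g h g' h' : FING M -> Ph M g h -> Ph M g' h' -> Ph M (g * g') (h * h').
  move=> fM h1 h2; rewrite /Ph -iota_mul hM; [exact: iota_hat|exact: iota_hat|].
  by exists h, h'.
have Ph_mono M M' g h : FING M -> FING M' -> subset M M' -> Ph M g h -> Ph M' g h.
  by move=> fM fM' MM; exact: comp_mono (hio g) fM fM' MM.
(* Continuity of [phi]: at a fixed level, any [x] can be replaced by the image [iota w] of an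
   element of [G]. *)
have approx M x : FING M -> hat x -> exists L, FING L /\ forall w, x L w -> phi (iota w) M = phi x M.
  move=> fM hx; have [L [fL hL]] := hC M fM; exists L; split=> // w xw.
  apply: hL => //; first exact: iota_hat.
  exact: (comp_eq (iota_hat w) hx fL (iota_in w fL)).
have Ph_surj M h : FING M -> exists g, Ph M g h.
  move=> fM; have [x [hx ex]] := hS _ (iota_hat h).
  have [L [fL hL]] := approx M x fM hx; have [w xw] := comp_ex hx fL.
  by exists w; rewrite /Ph (hL w xw) ex; exact: iota_in.
have Ph_IA M g h : FING M -> subset (@Kstar G) M -> Ph M g h -> cong M g h.
  by move=> fM KM; rewrite /Ph (hIA _ (iota_hat g) M fM KM) => -[].
have [a [aK base]] := abelian_action hl nl Ph_ex Ph_cong Ph_mono Ph_IA.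
have [s [IAs hs]] := dense_aut hl nl Ph_ex Ph_cong Ph_mul Ph_mono Ph_surj base aK fN.
exists s; split=> // x hx; have [L [fL hL]] := approx N x fN hx.
have fs := preim_FIN (s : aut_group G) fN; have fI := FIN_inter fL fs.
have [w xw] := comp_ex hx fI.
have xL : x L w by apply: (comp_mono hx fI fL _ xw) => v [].
have xs : x (fun v => N (af s v)) w by apply: (comp_mono hx fI fs _ xw) => v [].
rewrite -(hL w xL); apply: pred_ext => z.
by rewrite (act_cong _ hx fN xs) -(Ph_cong _ _ _ z fN (hs w)).
Qed.

End Hat.

Theorem theorem1p4 (Gam : group) (hfg : fin_gen Gam) (hnil : nilpotent Gam) :
  (* (1) for every subgroup G <= IA*(Gam), the natural map G^ -> IA*(Gam^)
         is well defined and injective, i.e. C(G,Gam) = {e} *)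
  (forall Gsub : aut_group Gam -> Prop,
     subgroup Gsub -> (forall s, Gsub s -> IA s) ->
     (forall g, completion_elem Gsub g -> IAhat (nu Gsub g)) /\
     (forall g1 g2, completion_elem Gsub g1 -> completion_elem Gsub g2 ->
        (forall x, hat x -> nu Gsub g1 x = nu Gsub g2 x) -> g1 = g2))
  /\
  (* (2) the image of IA*(Gam) is dense in IA*(Gam^) *)
  (forall phi : Fam Gam -> Fam Gam, IAhat phi ->
     forall N, FING N -> exists s : aut Gam, IA s /\
       forall x, hat x -> act s x N = phi x N).
Proof.
have pG := nilpotent_polycyclic hfg hnil; split.
  move=> Gs sG hIA; split; first by move=> g; exact: nu_IAhat.
  by move=> g1 g2 h1 h2; exact: nu_inj.
by move=> phi hphi N fN; exact: IAhat_dense.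
Qed.
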